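(* Let $\varepsilon>0$. The $L^2$-gradient flow of Bellettini's energy $$\mathcal{W}^{\mathrm{Be}}_\varepsilon(u)=\frac12\int_\Omega \left(\operatorname{div}\frac{\nabla u}{|\nabla u|}\right)^2\left(\frac{\varepsilon}{2}|\nabla u|^2+\frac{1}{\varepsilon}W(u)\right)dx$$ is equivalent to the evolution equation $$\partial_t u=\frac{K(u)^2}{2}\left(\Delta u-\frac{1}{\varepsilon^2}W'(u)\right)+\frac12\nabla\left[K(u)^2\right]\cdot\nabla u-\frac1\varepsilon\operatorname{div}\left(P^u\,\frac{\nabla\left[K(u)h_\varepsilon(u)\right]}{|\nabla u|}\right),$$ where $$P^u=I_d-\frac{\nabla u}{|\nabla u|}\otimes\frac{\nabla u}{|\nabla u|},\qquad h_\varepsilon(u)=\frac{\varepsilon}{2}|\nabla u|^2+\frac1\varepsilon W(u),\qquad K(u)=\operatorname{div}\left(\frac{\nabla u}{|\nabla u|}\right).$$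
   Context: $\Omega\subset\mathbb{R}^N$ is open, bounded, with Lipschitz boundary, and $W(s)=\frac12 s^2(1-s)^2$ is the double-well potential. $I_d$ is the identity matrix and $(a\otimes b)_{ij}=a_ib_j$. The $L^2$-gradient of an energy $F$ at $u$ is the function $\nabla F(u)$ such that $\lim_{s\to0}\frac{F(u+sw)-F(u)}{s}=\int_\Omega \nabla F(u)\,w\,dx$ for all $w\in C_c^\infty(\Omega)$. Here $u$ is smooth and $\nabla u\neq0$, so that the expressions involving $\nabla u/|\nabla u|$ make sense. The phrase ''the $L^2$-gradient flow of $F$ is equivalent to an evolution equation'' means that, after the constant rescaling of time by the factor $\varepsilon$, the gradient flow of $F$, i.e. $\partial_t u=-\frac{1}{\varepsilon}\nabla F(u)$, is exactly the stated equation. *)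

(* Defs.v *)
From HB Require Import structures.
From mathcomp Require Import all_boot all_order all_algebra.
From mathcomp Require Import all_classical all_reals all_analysis.

Set Implicit Arguments.
Unset Strict Implicit.
Unset Printing Implicit Defensive.

Import Order.TTheory GRing.Theory Num.Theory.
Import numFieldNormedType.Exports.

Local Open Scope classical_set_scope.
Local Open Scope ring_scope.

(* The sigma-algebra on R^n is the one generated by the coordinates, i.e. the
   n-fold product of the Borel sigma-algebra of R (the library's choice for
   n.-tuple); it is the Borel sigma-algebra of R^n. *)
Definition rV_display : measure_display -> measure_display.
Proof. exact. Qed.

Section measurable_rV.
Variables (R : realType) (n : nat).

Definition rV_coord (i : 'I_n) (x : 'rV[R]_n) : measurableTypeR R := x ord0 i.

Let rV_set0 : g_sigma_preimage rV_coord set0.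
Proof. exact: sigma_algebra0. Qed.

Let rV_setC A : g_sigma_preimage rV_coord A ->
  g_sigma_preimage rV_coord (~` A).
Proof. exact: sigma_algebraC. Qed.

Let rV_bigcup (F : _^nat) : (forall i, g_sigma_preimage rV_coord (F i)) ->
  g_sigma_preimage rV_coord (\bigcup_i (F i)).
Proof. exact: sigma_algebra_bigcup. Qed.

HB.instance Definition _ := @isMeasurable.Build (rV_display default_measure_display)
  'rV[R]_n (g_sigma_preimage rV_coord) rV_set0 rV_setC rV_bigcup.

Lemma measurable_rV_coord i : measurable_fun setT (rV_coord i).
Proof.
move=> _ Y mY; rewrite setTI; apply: sub_sigma_algebra => /=.
rewrite -bigcup_seq/=; exists i => /=; first by rewrite mem_index_enum.
by exists Y => //; rewrite setTI.
Qed.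

Lemma measurable_fun_rVP d (T : measurableType d) (f : T -> 'rV[R]_n) :
  (forall i, measurable_fun setT (rV_coord i \o f)) -> measurable_fun setT f.
Proof.
move=> mf.
suff : g_sigma_preimage (fun i => rV_coord i \o f) `<=` measurable.
  by rewrite g_sigma_preimage_comp => prefS _ A mA; apply: prefS; exists A.
apply: smallest_sub; first exact: sigma_algebra_measurable.
by move=> A; rewrite -bigcup_seq => -[i _ [B mB <-]]; exact: mf.
Qed.

End measurable_rV.

Section lebesgue_rV.
Variable R : realType.

Definition rV_cons n (p : measurableTypeR R * 'rV[R]_n) : 'rV[R]_n.+1 :=
  row_mx (const_mx p.1 : 'rV[R]_1) p.2.

Definition rV_uncons n (x : 'rV[R]_n.+1) : measurableTypeR R * 'rV[R]_n :=
  (x ord0 ord0, rsubmx (x : 'rV[R]_(1 + n))).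

Lemma rV_consK n : cancel (@rV_cons n) (@rV_uncons n).
Proof.
move=> [a v]; rewrite /rV_uncons /rV_cons /= row_mxKr; congr pair.
have -> : (ord0 : 'I_n.+1) = lshift n (ord0 : 'I_1) by apply: val_inj.
by apply: etrans (row_mxEl _ _ _ _) _; rewrite mxE.
Qed.

Lemma rV_cons0 n p : @rV_cons n p ord0 ord0 = p.1.
Proof. exact: (congr1 fst (rV_consK p)). Qed.

Lemma rV_consS n p (i : 'I_n) : rV_cons p ord0 (lift ord0 i) = p.2 ord0 i.
Proof.
have -> : lift ord0 i = rshift 1 i by apply: val_inj.
exact: row_mxEr.
Qed.

Lemma measurable_rV_cons n : measurable_fun setT (@rV_cons n).
Proof.
apply: measurable_fun_rVP => i; case: (unliftP ord0 i) => [j|] ->.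
- rewrite (_ : _ \o _ = @rV_coord R n j \o snd).
    by apply: measurableT_comp => //; exact: measurable_rV_coord.
  by apply/funext => p; exact: rV_consS.
- rewrite (_ : _ \o _ = fst)//.
  by apply/funext => p; exact: rV_cons0.
Qed.

Lemma measurable_rV_uncons n : measurable_fun setT (@rV_uncons n).
Proof.
apply/measurable_fun_pairP; split.
- exact: (@measurable_rV_coord R n.+1 ord0).
- apply: measurable_fun_rVP => i.
  rewrite (_ : _ \o _ = @rV_coord R n.+1 (lift ord0 i)).
    exact: measurable_rV_coord.
  apply/funext => x; rewrite /rV_coord /= !mxE.
  by congr (x _ _); exact: val_inj.
Qed.

Section step.
Variables (n : nat) (mu : {sigma_finite_measure set 'rV[R]_n -> \bar R}).

Definition lebesgue_rV_step : set 'rV[R]_n.+1 -> \bar R :=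
  pushforward (@lebesgue_measure R \x mu)%E (@rV_cons n).

Let mcons A : measurable A -> measurable (@rV_cons n @^-1` A).
Proof.
by move=> mA; rewrite -[X in measurable X]setTI; exact: measurable_rV_cons.
Qed.

Let lebesgue_rV_step0 : lebesgue_rV_step set0 = 0%E.
Proof. by rewrite /lebesgue_rV_step /pushforward preimage_set0 measure0. Qed.

Let lebesgue_rV_step_ge0 A : (0 <= lebesgue_rV_step A)%E.
Proof. by rewrite /lebesgue_rV_step /pushforward measure_ge0. Qed.

Let lebesgue_rV_step_sigma_additive : semi_sigma_additive lebesgue_rV_step.
Proof.
move=> F mF tF mUF; rewrite /lebesgue_rV_step /pushforward preimage_bigcup.
apply: measure_semi_sigma_additive => //.
- by move=> k; exact: mcons.
- apply/trivIsetP => /= i j _ _ ij; rewrite -preimage_setI.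
  by move/trivIsetP : tF => /(_ _ _ _ _ ij) ->//; rewrite preimage_set0.
- by rewrite -preimage_bigcup; exact: mcons.
Qed.

HB.instance Definition _ := isMeasure.Build _ _ _ lebesgue_rV_step
  lebesgue_rV_step0 lebesgue_rV_step_ge0 lebesgue_rV_step_sigma_additive.

Let lebesgue_rV_step_sigma_finite : sigma_finite setT lebesgue_rV_step.
Proof.
have /sigma_finiteP[F [TF ndF Foo]] := sigma_finiteT (@lebesgue_measure R).
have /sigma_finiteP[G [TG ndG Goo]] := sigma_finiteT mu.
exists (fun k => @rV_uncons n @^-1` (F k `*` G k)).
  apply/seteqP; split => // x _.
  have [k _ Fk] : (\bigcup_k F k) (rV_uncons x).1 by rewrite -TF.
  have [l _ Gl] : (\bigcup_k G k) (rV_uncons x).2 by rewrite -TG.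
  exists (maxn k l) => //; split => /=.
  - by move: Fk; exact/subsetPset/ndF/leq_maxl.
  - by move: Gl; exact/subsetPset/ndG/leq_maxr.
move=> k; have [mF Fk] := Foo k; have [mG Gk] := Goo k; split.
  rewrite -[X in measurable X]setTI; apply: measurable_rV_uncons => //.
  exact: measurableX.
rewrite /lebesgue_rV_step /pushforward -comp_preimage.
rewrite (_ : _ \o _ = id) ?preimage_id; last exact/funext/rV_consK.
by rewrite product_measure1E// lte_mul_pinfty// ge0_fin_numE.
Qed.

HB.instance Definition _ := Measure_isSigmaFinite.Build _ _ _ lebesgue_rV_step
  lebesgue_rV_step_sigma_finite.

End step.

Fixpoint lebesgue_rV n : {sigma_finite_measure set 'rV[R]_n -> \bar R} :=
  match n with
  | 0 => \d_(0 : 'rV[R]_0)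
  | m.+1 => lebesgue_rV_step (lebesgue_rV m)
  end.

Lemma lebesgue_rV_box n (A : 'I_n -> set (measurableTypeR R)) :
  (forall i, measurable (A i)) ->
  lebesgue_rV n [set x | forall i, A i (x ord0 i)] =
  (\prod_(i < n) lebesgue_measure (A i))%E.
Proof.
elim: n A => [A _|n IH A mA].
  by rewrite big_ord0 /= diracE mem_set// => -[].
rewrite big_ord_recl /= /lebesgue_rV_step /pushforward.
rewrite -(IH (fun i => A (lift ord0 i)))//.
rewrite -product_measure1E//.
  congr product_measure1; apply/seteqP; split => -[a v] /=.
  - move=> Av; split => [|i]; first by have := Av ord0; rewrite rV_cons0.
    by have := Av (lift ord0 i); rewrite rV_consS.
  - move=> [Aa Av] i; case: (unliftP ord0 i) => [j|] ->.
      by rewrite rV_consS; exact: Av.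
    by rewrite rV_cons0.
rewrite [X in measurable X](_ : _ = \big[setI/setT]_(i < n)
    ([set: _] `&` (@rV_coord R n i @^-1` A (lift ord0 i)))).
  by apply: bigsetI_measurable => i _; exact: measurable_rV_coord.
apply/seteqP; split => v; rewrite -bigcap_seq => /= Av.
  by move=> i _; split => //; exact: Av.
by move=> i; have [] := Av i (mem_index_enum _).
Qed.

End lebesgue_rV.

Section calculus.
Variables (R : realType) (N : nat).
Implicit Types (u : 'rV[R]_N -> R) (X : 'rV[R]_N -> 'rV[R]_N).
Implicit Types (a b x : 'rV[R]_N).

(* The library norm `|x| on 'rV[R]_N is the maximum norm; enorm is the
   Euclidean one. *)
Definition dotv a b : R := \sum_(i < N) a ord0 i * b ord0 i.

Definition enorm a : R := Num.sqrt (dotv a a).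

Definition tensor a b : 'M[R]_N := \matrix_(i, j) (a ord0 i * b ord0 j).

(* Elements of R^N are row vectors, hence the transpositions. *)
Definition mxapp (A : 'M[R]_N) a : 'rV[R]_N := (A *m a^T)^T.

Definition ebase (i : 'I_N) : 'rV[R]_N := delta_mx ord0 i.

Definition grad u x : 'rV[R]_N := \row_i 'D_(ebase i) u x.

Definition divergence X x : R := \sum_(i < N) 'D_(ebase i) (fun y => X y ord0 i) x.

Definition laplacian u x : R := divergence (grad u) x.

End calculus.

Section smooth.
Variables (R : realType) (V : normedModType R).

Definition iter_derive (s : seq V) (f : V -> R) : V -> R :=
  foldr (fun v g => 'D_v g) f s.

(* Infinite differentiability on an open set A: all iterated directional
   derivatives exist and are (Frechet) differentiable at the points of A. *)
Definition smooth_on (A : set V) (f : V -> R) : Prop :=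
  forall s x, A x -> differentiable (iter_derive s f) x.

End smooth.

(* Near every boundary point, up to an isometry of the coordinates, Omega is
   the strict epigraph of a Lipschitz function of the last n coordinates. *)
Definition lipschitz_boundary (R : realType) (n : nat)
    (Omega : set 'rV[R]_n.+1) : Prop :=
  forall p, closure Omega p -> closure (~` Omega) p ->
  exists (Q : 'M[R]_n.+1) (gamma : 'rV[R]_n -> R) (k : R),
    [/\ Q *m Q^T = 1%:M, k.-lipschitz gamma &
      \forall x \near p,
        Omega x <-> gamma (rV_uncons (x *m Q)).2 < (rV_uncons (x *m Q)).1].

Section gradient_flow.
Variables (R : realType) (N : nat) (Omega : set 'rV[R]_N).
Local Notation lambda := (lebesgue_rV R N).

Definition test_function (w : 'rV[R]_N -> R) : Prop :=
  [/\ smooth_on setT w, compact (closure [set x | w x != 0]) &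
      closure [set x | w x != 0] `<=` Omega].

(* g is only determined almost everywhere; the integrability clause makes
   the right-hand side meaningful. *)
Definition is_L2_gradient (F : ('rV[R]_N -> R) -> \bar R)
    (u g : 'rV[R]_N -> R) : Prop :=
  forall w, test_function w ->
    lambda.-integrable Omega (fun x => (g x * w x)%:E) /\
    ((F (fun x => (u x + s * w x)%R) - F u) * s^-1%:E)%E @[s --> 0^'] -->
      (\int[lambda]_(x in Omega) (g x * w x)%:E)%E.

(* The flow du/dt = - (1/eps) grad F(u) at the times t in I. *)
Definition rescaled_L2_gradient_flow (eps : R)
    (F : ('rV[R]_N -> R) -> \bar R) (I : set R) (u : R -> 'rV[R]_N -> R) : Prop :=
  forall t, I t -> exists2 g, is_L2_gradient F (u t) g &
    forall x, Omega x -> derive1 (fun s => u s x) t = - eps^-1 * g x.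

End gradient_flow.

Section Bellettini.
Variables (R : realType) (N : nat) (eps : R).
Implicit Types (u : 'rV[R]_N -> R) (x : 'rV[R]_N).

Definition double_well (s : R) : R := 2^-1 * s ^+ 2 * (1 - s) ^+ 2.

Definition unit_normal u x : 'rV[R]_N := (enorm (grad u x))^-1 *: grad u x.

Definition curvature u : 'rV[R]_N -> R := divergence (unit_normal u).

Definition energy_density u x : R :=
  eps / 2 * enorm (grad u x) ^+ 2 + eps^-1 * double_well (u x).

Definition tangent_proj u x : 'M[R]_N :=
  1%:M - tensor (unit_normal u x) (unit_normal u x).

Definition Bellettini_energy (Omega : set 'rV[R]_N) u : \bar R :=
  ((2^-1)%:E * \int[lebesgue_rV R N]_(x in Omega)
     (curvature u x ^+ 2 * energy_density u x)%:E)%E.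

Definition Bellettini_rhs u x : R :=
  curvature u x ^+ 2 / 2 *
    (laplacian u x - (eps ^+ 2)^-1 * derive1 double_well (u x))
  + 2^-1 * dotv (grad (fun y => curvature u y ^+ 2) x) (grad u x)
  - eps^-1 * divergence (fun y =>
      mxapp (tangent_proj u y)
        ((enorm (grad u y))^-1 *:
           grad (fun z => curvature u z * energy_density u z) y)) x.

End Bellettini.

(* Main.v *)
Require Import Defs.
From mathcomp Require Import all_boot all_order all_algebra.
From mathcomp Require Import all_classical all_reals all_analysis.
From mathcomp Require Import measurable_realfun lebesgue_integral_under ring lra.
Import Order.TTheory GRing.Theory Num.Theory.
Import numFieldNormedType.Exports.
Local Open Scope classical_set_scope.
Local Open Scope ring_scope.

(** Write nu = grad u / |grad u|, K = div nu, h for the energy density, and let w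
    be a test function.  Along u + s w the derivative of nu at s = 0 is the
    tangential part of grad w divided by |grad u| ([tflux]); derivatives in s and
    in x commute, so the derivative of K is the divergence of that field, and
    the derivative of the integrand K^2 h / 2 is

      K h div (tflux u w) + K^2 / 2 (eps grad u . grad w + W'(u) w / eps).

    The tangential projection is symmetric, hence
    grad (K h) . tflux u w = tflux u (K h) . grad w ([tflux_sym]), and the product
    rule turns the expression above into G w + div T.  Here G is - eps times the
    right-hand side of the evolution equation and T is a smooth field supported
    in the support of w ([first_variation_divergence]).  Since div T has integral
    zero, G is the L^2 gradient.

    The derivative has to be taken under the integral sign although grad u may
    degenerate at the boundary of Omega.  Off the support of w the integrand does
    not depend on s, and on this compact support grad (u + s w) stays away from 0
    for small s and the s-derivative of the integrand is bounded.  For uniformity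
    in s, the pair (s, x) is one variable of the product space R * R^N, on which the
    integrand is smooth; the geometric quantities are therefore defined on any
    normed space with a family of directions, and are used both on R^N and on
    R * R^N ([Bellettini_first_variation]).

    Smoothness comes from a coinduction principle: the functions built from
    smooth ones by sums, products, inverses, square roots and composition form a
    class closed under directional derivatives ([smooth_coind],
    [elementary_derive]).  The divergence theorem for compactly supported
    functions is an induction on the dimension, by Fubini and the fundamental
    theorem of calculus in the first coordinate ([integral_partial_support]).

    For the flow, the two formulations differ by the choice of a representative
    of the gradient.  On Omega the gradient in the definition of the flow equals
    - eps times the time derivative of u, which is continuous, and continuous
    gradients are unique by the fundamental lemma of the calculus of variations
    ([L2_gradient_unique]). *)

Set Implicit Arguments.
Unset Strict Implicit.
Unset Printing Implicit Defensive.

(** * Smooth functions on an open set *)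

Section calculus.
Variables (R : realType) (V : normedModType R).
Implicit Types (A B : set V) (f g : V -> R).

(** Differentiability is stated with little-o remainders, not as a local
    property; this is the case to which locality reduces, by subtraction. *)
Lemma near0_differentiable f (x : V) :
  (\forall y \near x, f y = 0) -> differentiable f x.
Proof.
move=> f0.
have fx0 : f x = 0 by exact: nbhs_singleton f0.
have cst0 : continuous (\0 : {linear V -> R}) by move=> z; exact: cvg_cst.
have e0 : f \o shift x = cst (f x) + (\0 : {linear V -> R}) +o_ 0 id.
  apply/eqaddoP => e e0; near=> h.
  rewrite /= fx0 /= !fctE /= [f _](_ : _ = 0) ?subr0 ?addr0 ?subrr ?normr0 ?mulr_ge0// 1?ltW//.
  near: h; move: f0; rewrite (near_shift 0 x) /=.
  by apply: filterS => z; rewrite subr0.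
by apply/diff_locallyP; rewrite (diff_unique cst0 e0).
Unshelve. all: by end_near. Qed.

Lemma near_eq_differentiable f g (x : V) :
  {near x, f =1 g} -> differentiable f x -> differentiable g x.
Proof.
move=> fg df; rewrite (_ : g = f + (g - f)); last by rewrite addrC subrK.
apply: differentiableD => //; apply: near0_differentiable.
by move: fg; apply: filterS => y fgy; rewrite !fctE fgy subrr.
Qed.

Lemma open_near A x : open A -> A x -> \forall y \near x, A y.
Proof. by move=> oA Ax; exact: open_nbhs_nbhs. Qed.

Lemma eq_on_derive A f g v x : open A -> A x -> (forall y, A y -> f y = g y) ->
  'D_v f x = 'D_v g x.
Proof.
move=> oA Ax fg; apply: near_eq_derive.
by near=> y; apply: fg; near: y; exact: open_near.
Unshelve. all: by end_near. Qed.

Lemma derive_comp_real (phi : R -> R) f v x :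
  differentiable f x -> derivable phi (f x) 1 ->
  'D_v (phi \o f) x = derive1 phi (f x) * 'D_v f x.
Proof.
move=> df dphi; have dphi' := (derivable1_diffP _ _).1 dphi.
rewrite deriveE; last exact: differentiable_comp.
by rewrite diff_comp// /= deriv1E// deriveE// /GRing.scale/= mulrC.
Qed.

Lemma iter_derive_rcons s v f : iter_derive (rcons s v) f = iter_derive s ('D_v f).
Proof. by rewrite /iter_derive -cats1 foldr_cat. Qed.

Lemma eq_on_differentiable A f g x : open A -> A x ->
  (forall y, A y -> f y = g y) -> differentiable f x -> differentiable g x.
Proof.
move=> oA Ax fg; apply: near_eq_differentiable.
by near=> y; apply: fg; near: y; exact: open_near.
Unshelve. all: by end_near. Qed.

(** Coinduction: to be smooth it is enough to belong to some class of
    differentiable functions that contains, up to equality on A, all the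
    directional derivatives of its members. *)
Lemma smooth_coind A (P : (V -> R) -> Prop) : open A ->
  (forall f, P f -> (forall x, A x -> differentiable f x) /\
     forall v, exists2 g, P g & forall x, A x -> 'D_v f x = g x) ->
  forall f, P f -> smooth_on A f.
Proof.
move=> oA coP f Pf s x Ax.
suff [g Pg fg] : exists2 g, P g & forall x, A x -> g x = iter_derive s f x.
  by apply: (eq_on_differentiable oA Ax fg); exact: (coP _ Pg).1.
elim: s => [|v s [g Pg IH]] /=; first by exists f.
have [dg /(_ v)[h Ph gh]] := coP _ Pg.
exists h => // y Ay; rewrite -gh//.
exact: eq_on_derive IH.
Qed.

Lemma smooth_on_differentiable A f x :
  smooth_on A f -> A x -> differentiable f x.
Proof. by move=> sf; exact: (sf [::]). Qed.

Lemma smooth_on_derive A f v : smooth_on A f -> smooth_on A ('D_v f).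
Proof. by move=> sf s x Ax; rewrite -iter_derive_rcons; exact: sf. Qed.

Lemma smooth_on_ext A f g : open A -> (forall x, A x -> f x = g x) ->
  smooth_on A f -> smooth_on A g.
Proof.
move=> oA fg sf.
apply: (@smooth_coind A (fun g => exists2 f, smooth_on A f &
  forall x, A x -> f x = g x)) => //; last by exists f.
move=> {fg sf f}h [f sf fh]; split => [x Ax|v].
  by apply: (eq_on_differentiable oA Ax fh); exact: smooth_on_differentiable Ax.
exists ('D_v f); first by exists ('D_v f) => //; exact: smooth_on_derive.
by move=> x Ax; apply: (eq_on_derive _ oA Ax) => y Ay; rewrite fh.
Qed.

Lemma smooth_onS A B f : A `<=` B -> smooth_on B f -> smooth_on A f.
Proof. by move=> AB sf s x Ax; exact/sf/AB. Qed.

Lemma smooth_onU A B f : smooth_on A f -> smooth_on B f -> smooth_on (A `|` B) f.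
Proof. by move=> sA sB s x [Ax|Bx]; [exact: sA|exact: sB]. Qed.

Lemma smooth_on_cst A (c : R) : open A -> smooth_on A (cst c).
Proof.
move=> oA; apply: (@smooth_coind A (fun f => exists c, f = cst c)) => //.
  move=> _ [{}c ->]; split => [x _|v]; first exact: differentiable_cst.
  by exists (cst 0) => [|x _]; [exists 0|rewrite derive_cst].
by exists c.
Qed.

Lemma smooth_on_linear A (f : {linear V -> R}) : open A ->
  continuous f -> smooth_on A f.
Proof.
move=> oA cf; apply: (@smooth_coind A (fun g => g = (f : V -> R) \/
  exists c, g = cst c)) => //; last by left.
move=> _ [->|[c ->]]; split=> [p _|v].
- exact: linear_differentiable.
- exists (cst (f v)); first by right; exists (f v).
  by move=> p _; rewrite deriveE ?diff_lin//; exact: linear_differentiable.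
- exact: differentiable_cst.
- by exists (cst 0); [right; exists 0|move=> p _; rewrite derive_cst].
Qed.

End calculus.

Section smooth_closure.
Variables (R : realType) (V : normedModType R) (A : set V).
Hypothesis oA : open A.
Implicit Types f g : V -> R.

(** Closing under derivatives requires all the operations at once: the
    derivative of a square root involves an inverse and a product. *)
Inductive elementary : (V -> R) -> Prop :=
| elem_base f : smooth_on A f -> elementary f
| elem_add f g : elementary f -> elementary g -> elementary (fun x => f x + g x)
| elem_mul f g : elementary f -> elementary g -> elementary (fun x => f x * g x)
| elem_inv f : (forall x, A x -> f x != 0) -> elementary f ->
    elementary (fun x => (f x)^-1)
| elem_sqrt f : (forall x, A x -> 0 < f x) -> elementary f ->
    elementary (fun x => Num.sqrt (f x))
| elem_comp (phi : R -> R) f : smooth_on setT phi -> elementary f ->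
    elementary (phi \o f).

Lemma elementary_derive f : elementary f ->
  (forall x, A x -> differentiable f x) /\
  forall v, exists2 g, elementary g & forall x, A x -> 'D_v f x = g x.
Proof.
elim=> {f}[f sf|f g ef [df Df] eg [dg Dg]|f g ef [df Df] eg [dg Dg]
  |f f0 ef [df Df]|f f0 ef [df Df]|phi f sphi ef [df Df]].
- split=> [x Ax|v]; first exact: smooth_on_differentiable Ax.
  by exists ('D_v f) => //; apply/elem_base/smooth_on_derive.
- split=> [x Ax|v]; first by apply: differentiableD; [exact: df|exact: dg].
  have [f' ef' ff'] := Df v; have [g' eg' gg'] := Dg v.
  exists (fun x => f' x + g' x) => [|x Ax]; first exact: elem_add.
  rewrite -ff'// -gg'// -[LHS]/('D_v (f + g) x) deriveD//.
    exact/diff_derivable/df.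
  exact/diff_derivable/dg.
- split=> [x Ax|v]; first by apply: differentiableM; [exact: df|exact: dg].
  have [f' ef' ff'] := Df v; have [g' eg' gg'] := Dg v.
  exists (fun x => f x * g' x + g x * f' x) => [|x Ax].
    by apply: elem_add; apply: elem_mul.
  rewrite -ff'// -gg'// -[LHS]/('D_v (f * g) x) deriveM//.
    exact/diff_derivable/df.
  exact/diff_derivable/dg.
- split=> [x Ax|v]; first by apply: differentiableV; [exact: df|exact: f0].
  have [f' ef' ff'] := Df v.
  exists (fun x => -1 * ((f x)^-1 * (f x)^-1) * f' x) => [|x Ax].
    apply: elem_mul => //; apply: elem_mul.
      exact/elem_base/(@smooth_on_cst _ _ _ (-1)).
    by apply: elem_mul; exact: elem_inv.
  rewrite -ff'// deriveV//; [|exact: f0|exact/diff_derivable/df].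
  by rewrite -invfM -expr2 mulN1r.
- split=> [x Ax|v].
    apply: (@differentiable_comp _ _ _ _ f Num.sqrt); first exact: df.
    apply/derivable1_diffP.
    have [? _] := is_derive1_sqrt (f0 _ Ax); assumption.
  have [f' ef' ff'] := Df v.
  exists (fun x => (2 * Num.sqrt (f x))^-1 * f' x) => [|x Ax].
    apply: elem_mul => //; apply: elem_inv => [x Ax|].
      by rewrite mulf_neq0// sqrtr_eq0 -ltNge f0.
    by apply: elem_mul; [exact/elem_base/(@smooth_on_cst _ _ _ 2)|exact: elem_sqrt].
  have [? s'] := is_derive1_sqrt (f0 _ Ax).
  by rewrite -ff'// derive_comp_real//; [rewrite derive1E s'|exact: df].
- have dphi y : differentiable phi y by exact: (sphi [::]).
  split=> [x Ax|v]; first by apply: differentiable_comp; [exact: df|exact: dphi].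
  have [f' ef' ff'] := Df v.
  exists (fun x => ('D_1 phi \o f) x * f' x) => [|x Ax].
    by apply: elem_mul => //; apply: elem_comp => //; exact: smooth_on_derive.
  rewrite -ff'// derive_comp_real//; [by rewrite derive1E|exact: df|].
  exact/diff_derivable/dphi.
Qed.

Lemma elementary_smooth f : elementary f -> smooth_on A f.
Proof. exact: (smooth_coind oA elementary_derive). Qed.

Lemma smooth_onD f g : smooth_on A f -> smooth_on A g ->
  smooth_on A (fun x => f x + g x).
Proof. by move=> sf sg; apply/elementary_smooth/elem_add; exact: elem_base. Qed.

Lemma smooth_onM f g : smooth_on A f -> smooth_on A g ->
  smooth_on A (fun x => f x * g x).
Proof. by move=> sf sg; apply/elementary_smooth/elem_mul; exact: elem_base. Qed.

Lemma smooth_onV f : (forall x, A x -> f x != 0) -> smooth_on A f ->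
  smooth_on A (fun x => (f x)^-1).
Proof. by move=> f0 sf; apply/elementary_smooth/elem_inv => //; exact: elem_base. Qed.

Lemma smooth_on_sqrt f : (forall x, A x -> 0 < f x) -> smooth_on A f ->
  smooth_on A (fun x => Num.sqrt (f x)).
Proof. by move=> f0 sf; apply/elementary_smooth/elem_sqrt => //; exact: elem_base. Qed.

Lemma smooth_on_comp (phi : R -> R) f : smooth_on setT phi -> smooth_on A f ->
  smooth_on A (phi \o f).
Proof. by move=> sphi sf; apply/elementary_smooth/elem_comp => //; exact: elem_base. Qed.

Lemma smooth_onZ (c : R) f : smooth_on A f -> smooth_on A (fun x => c * f x).
Proof. by apply: smooth_onM; exact: (@smooth_on_cst _ _ _ c). Qed.

Lemma smooth_onB f g : smooth_on A f -> smooth_on A g ->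
  smooth_on A (fun x => f x - g x).
Proof.
move=> sf sg; apply: smooth_onD => //.
by under eq_fun do rewrite -mulN1r; exact: smooth_onZ.
Qed.

Lemma smooth_onX f n : smooth_on A f -> smooth_on A (fun x => f x ^+ n).
Proof.
move=> sf; elim: n => [|n IH]; first exact: (@smooth_on_cst _ _ _ 1).
by under eq_fun do rewrite exprS; exact: smooth_onM.
Qed.

Lemma smooth_on_sum n (F : 'I_n -> V -> R) : (forall i, smooth_on A (F i)) ->
  smooth_on A (fun x => \sum_(i < n) F i x).
Proof.
elim: n F => [|n IH] F sF.
  by under eq_fun do rewrite big_ord0; exact: (@smooth_on_cst _ _ _ 0).
by under eq_fun do rewrite big_ord_recl; apply: smooth_onD => //; exact: IH.
Qed.

Lemma smooth_on_prod n (F : 'I_n -> V -> R) : (forall i, smooth_on A (F i)) ->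
  smooth_on A (fun x => \prod_(i < n) F i x).
Proof.
elim: n F => [|n IH] F sF.
  by under eq_fun do rewrite big_ord0; exact: (@smooth_on_cst _ _ _ 1).
by under eq_fun do rewrite big_ord_recl; apply: smooth_onM => //; exact: IH.
Qed.

Lemma smooth_on_continuous f x : smooth_on A f -> A x -> {for x, continuous f}.
Proof.
move=> sf Ax; apply: differentiable_continuous.
exact: smooth_on_differentiable Ax.
Qed.

End smooth_closure.

(** * Symmetry of second derivatives, and slices of a product *)

Section schwarz.
Variables (R : realType) (V : normedModType R).
Implicit Types (f : V -> R) (p v w : V) (A : set V).

Lemma derive_line f v p (a : R) :
  'D_1 (fun b : R => f (b *: v + p)) a = 'D_v f (a *: v + p).
Proof.
rewrite /derive; set g := (X in lim (X @ _) = _); set g' := (X in _ = lim (X @ _)).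
suff -> : g = g' by [].
by apply/funext => h; rewrite /g /g'/= [h%:A]mulr1 scalerDl addrA.
Qed.

Lemma derivable_line f v p (a : R) : derivable f (a *: v + p) v ->
  derivable (fun b : R => f (b *: v + p)) a 1.
Proof.
rewrite /derivable; set g := (X in cvg (X @ _)); set g' := (X in _ -> cvg (X @ _)).
suff -> : g = g' by [].
by apply/funext => h; rewrite /g /g'/= [h%:A]mulr1 scalerDl addrA.
Qed.

Lemma MVT_line f v p (h : R) : 0 < h ->
  (forall a : R, 0 <= a <= h -> derivable f (a *: v + p) v) ->
  exists2 a : R, 0 <= a <= h & f (h *: v + p) - f p = h * 'D_v f (a *: v + p).
Proof.
move=> h0 df.
have dl a : a \in `[0, h] -> derivable (fun b : R => f (b *: v + p)) a 1.
  by rewrite in_itv/= => ah; apply: derivable_line; exact: df.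
have [|a ah e] := @MVT_segment R (fun b : R => f (b *: v + p))
    (fun a => 'D_v f (a *: v + p)) 0 h (ltW h0) _ (derivable_within_continuous dl).
  move=> a ah; rewrite -derive_line; apply: derivableP; apply: dl.
  exact: subset_itv_oo_cc ah.
exists a; first by move: ah; rewrite in_itv.
by move: e; rewrite scale0r add0r subr0 mulrC.
Qed.

(** Two uses of the mean value theorem, first along v for the difference of f
    in the direction w, then along w for the derivative along v. *)
Lemma second_difference f A p v w (h : R) : smooth_on A f -> 0 < h ->
  (forall a b : R, 0 <= a <= h -> 0 <= b <= h -> A (a *: v + (b *: w + p))) ->
  exists a b : R, [/\ 0 <= a <= h, 0 <= b <= h &
    f (h *: v + (h *: w + p)) - f (h *: v + p) - f (h *: w + p) + f p =
    h * (h * 'D_w ('D_v f) (a *: v + (b *: w + p)))].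
Proof.
move=> sf h0 hA.
have h0h : 0 <= h <= h by rewrite lexx ltW.
have z0h : 0 <= (0 : R) <= h by rewrite lexx ltW.
pose g x := f (x + h *: w) - f x.
have dg x : A (h *: w + x) -> A x -> derivable g x v /\
    'D_v g x = 'D_v f (h *: w + x) - 'D_v f x.
  move=> Ahx Ax.
  have d1 : derivable (fun x => f (x + h *: w)) x v /\
      'D_v (fun x => f (x + h *: w)) x = 'D_v f (h *: w + x).
    have E : (fun k : R => k^-1 *: (((fun x => f (x + h *: w)) \o shift x) (k *: v) -
        f (x + h *: w))) =
        (fun k : R => k^-1 *: ((f \o shift (h *: w + x)) (k *: v) - f (h *: w + x))).
      by apply/funext => k /=; rewrite -addrA (addrC x).
    split; last by rewrite /derive E.
    rewrite /derivable E -/(derivable _ _ _).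
    by apply: diff_derivable; exact: smooth_on_differentiable sf Ahx.
  have d2 : derivable f x v.
    by apply: diff_derivable; exact: smooth_on_differentiable sf Ax.
  split; first exact: derivableB d1.1 d2.
  by rewrite -d1.2 -[LHS]/('D_v ((fun x => f (x + h *: w)) - f) x) deriveB//; exact: d1.1.
have hA1 a : 0 <= a <= h -> A (h *: w + (a *: v + p)).
  by move=> ah; rewrite addrCA; exact: hA.
have hA0 a : 0 <= a <= h -> A (a *: v + p).
  by move=> ah; have := hA a 0 ah z0h; rewrite scale0r add0r.
have [|a ah ea] := @MVT_line g v p h h0.
  by move=> a ah; apply: (dg _ _ _).1; [exact: hA1|exact: hA0].
have [|b bh eb] := @MVT_line ('D_v f) w (a *: v + p) h h0.
  move=> b bh; apply: diff_derivable.
  by apply: smooth_on_differentiable (smooth_on_derive _ sf) _; rewrite addrCA; exact: hA.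
exists a, b; split => //.
rewrite [a *: v + _]addrCA -eb -(dg _ (hA1 a ah) (hA0 a ah)).2 -ea /g.
by rewrite -[h *: v + p + _]addrA [p + h *: w]addrC; ring.
Qed.

Lemma ler_dist_half (X Y Z e : R) :
  `|Y - X| < e / 2 -> `|Z - X| < e / 2 -> `|Y - Z| <= e.
Proof.
move=> l1 l2; rewrite -(subrKA X) (le_trans (ler_normD _ _))//.
by rewrite [leRHS](splitr e) lerD ?ltW// distrC.
Qed.

Lemma continuous_ball (F G : V -> R) A p (e : R) : open A -> A p ->
  {for p, continuous F} -> {for p, continuous G} -> 0 < e ->
  exists2 r : R, 0 < r & forall q, ball p r q ->
    [/\ A q, `|F p - F q| < e & `|G p - G q| < e].
Proof.
move=> oA Ap /cvgrPdist_lt cF /cvgrPdist_lt cG e0.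
have /nbhs_ballP[r1 /= r10 B1] : nbhs p A by exact: open_nbhs_nbhs.
have /nbhs_ballP[r2 /= r20 B2] := cF _ e0.
have /nbhs_ballP[r3 /= r30 B3] := cG _ e0.
exists (Num.min r1 (Num.min r2 r3)); first by rewrite !lt_min r10 r20.
by move=> q Bq; split; [apply: B1|apply: B2|apply: B3]; apply: le_ball Bq;
  rewrite !ge_min lexx ?orbT.
Qed.

(** The second difference is symmetric in v and w, and each order of
    differentiation is its limit by [second_difference] and continuity. *)
Lemma smooth_schwarz f A p v w : open A -> smooth_on A f -> A p ->
  'D_v ('D_w f) p = 'D_w ('D_v f) p.
Proof.
move=> oA sf Ap.
have cont v' w' : {for p, continuous ('D_v' ('D_w' f))}.
  by apply: smooth_on_continuous Ap; do 2 apply: smooth_on_derive.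
apply/eqP; rewrite -subr_eq0 -normr_le0; apply/ler_addgt0Pl => e e0; rewrite addr0.
have e20 : 0 < e / 2 by rewrite divr_gt0.
have [r r0 B] := continuous_ball oA Ap (cont v w) (cont w v) e20.
pose m := `|v| + `|w| + 1.
have m0 : 0 < m by rewrite ltr_wpDl// addr_ge0.
(* With this step the whole parallelogram lies in the ball of radius r. *)
pose h := r / 2 / m.
have h0 : 0 < h by rewrite !divr_gt0.
have hB a b : 0 <= a <= h -> 0 <= b <= h -> ball p r (a *: v + (b *: w + p)).
  move=> /andP[a0 ah] /andP[b0 bh]; rewrite -ball_normE/=.
  rewrite addrA opprD addrCA subrr addr0 normrN.
  apply: le_lt_trans (ler_normD _ _) _; rewrite !normrZ !ger0_norm//.
  apply: (@le_lt_trans _ _ (h * m)).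
    rewrite /m !mulrDr mulr1 -addrA lerD ?ler_wpM2r//.
    by rewrite (@le_trans _ _ (h * `|w|)) ?ler_wpM2r// lerDl ltW.
  by rewrite /h divfK ?gt_eqF// ltr_pdivrMr// ltr_pMr// ltr1n.
have hBA a b : 0 <= a <= h -> 0 <= b <= h -> A (a *: v + (b *: w + p)).
  by move=> ah bh; have [] := B _ (hB a b ah bh).
have [a1 [b1 [a1h b1h e1]]] := second_difference (p := p) (v := v) (w := w)
  sf h0 hBA.
have hB' a b : 0 <= a <= h -> 0 <= b <= h -> ball p r (a *: w + (b *: v + p)).
  by move=> ah bh; rewrite addrCA; exact: hB.
have hBA' a b : 0 <= a <= h -> 0 <= b <= h -> A (a *: w + (b *: v + p)).
  by move=> ah bh; have [] := B _ (hB' a b ah bh).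
have [a2 [b2 [a2h b2h e2]]] := second_difference (p := p) (v := w) (w := v)
  sf h0 hBA'.
have e12 : 'D_w ('D_v f) (a1 *: v + (b1 *: w + p)) =
    'D_v ('D_w f) (a2 *: w + (b2 *: v + p)).
  apply/(mulfI (lt0r_neq0 h0))/(mulfI (lt0r_neq0 h0)); rewrite -e1 -e2.
  rewrite [h *: w + (h *: v + p)]addrCA; congr (_ + _).
  by rewrite -!addrA; congr (_ + _); rewrite addrC.
have [_ _] := B _ (hB _ _ a1h b1h); rewrite e12 => l1.
have [_ l2 _] := B _ (hB' _ _ a2h b2h).
exact: ler_dist_half l2 l1.
Qed.

End schwarz.

Section slices.
Variables (R : realType) (W : normedModType R).
Implicit Types (F : (R * W)%type -> R) (x v : W) (s : R).

Lemma derive_slice F s x v :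
  'D_v (fun y => F (s, y)) x = 'D_((0 : R), v) F (s, x).
Proof.
rewrite /derive; set g := (X in lim (X @ _) = _); set g' := (X in _ = lim (X @ _)).
suff -> : g = g' by [].
apply/funext => h; rewrite /g /g'/=; congr (_ *: (F _ - _)).
by congr pair; rewrite /= scaler0 add0r.
Qed.

Lemma derive1_slice F s x :
  derive1 (fun t => F (t, x)) s = 'D_((1 : R), (0 : W)) F (s, x).
Proof.
rewrite derive1E /derive.
set g := (X in lim (X @ _) = _); set g' := (X in _ = lim (X @ _)).
suff -> : g = g' by [].
apply/funext => h; rewrite /g /g'/=; congr (_ *: (F _ - _)).
by congr pair; rewrite /= scaler0 add0r.
Qed.

Lemma differentiable_slice F s x :
  differentiable F (s, x) -> differentiable (fun y => F (s, y)) x.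
Proof.
by move=> dF; apply: (@differentiable_comp _ _ _ _ (fun y => (s, y)) F).
Qed.

Lemma differentiable_slice1 F s x :
  differentiable F (s, x) -> differentiable (fun t : R => F (t, x)) s.
Proof.
by move=> dF; apply: (@differentiable_comp _ _ _ _ (fun t : R => (t, x)) F).
Qed.

(** The difference quotients of a slice are those of F in a direction tangent to
    the slice, so [derive_slice] is an equality of functions and can be iterated. *)
Lemma iter_derive_slice F s l :
  iter_derive l (fun y => F (s, y)) =
  (fun y => iter_derive [seq ((0 : R), v) | v <- l] F (s, y)).
Proof.
elim: l => [|v l IH] //=; apply/funext => x.
by rewrite IH derive_slice.
Qed.

Lemma smooth_on_slice (A : set (R * W)%type) F s :
  smooth_on A F -> smooth_on [set x | A (s, x)] (fun y => F (s, y)).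
Proof.
by move=> sF l x Ax; rewrite iter_derive_slice; apply: differentiable_slice; exact: sF.
Qed.

Lemma smooth_on_snd (A : set W) (u : W -> R) :
  smooth_on A u -> smooth_on [set p : (R * W)%type | A p.2] (fun p => u p.2).
Proof.
move=> su l [t x] /= Ax.
have -> : iter_derive l (fun p : (R * W)%type => u p.2) =
    iter_derive (map snd l) u \o snd.
  by elim: l => [|v l IH] //=; rewrite IH.
apply: differentiable_comp; last exact: su.
by apply: linear_differentiable => q; exact: cvg_snd.
Qed.

Lemma smooth_on_fst (A : set (R * W)%type) : open A ->
  smooth_on A (fun p => p.1).
Proof.
move=> oA; apply: (@smooth_on_linear _ _ _ fst) => // p; exact: cvg_fst.
Qed.

End slices.

Section derive_rules.
Variables (R : realType) (V : normedModType R).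
Implicit Types (f g : V -> R) (p v : V).

Lemma derive_add f g p v : differentiable f p -> differentiable g p ->
  'D_v (fun x => f x + g x) p = 'D_v f p + 'D_v g p.
Proof. by move=> df dg; apply: deriveD; exact: diff_derivable. Qed.

Lemma derive_sub f g p v : differentiable f p -> differentiable g p ->
  'D_v (fun x => f x - g x) p = 'D_v f p - 'D_v g p.
Proof. by move=> df dg; apply: deriveB; exact: diff_derivable. Qed.

Lemma derive_mul f g p v : differentiable f p -> differentiable g p ->
  'D_v (fun x => f x * g x) p = f p * 'D_v g p + g p * 'D_v f p.
Proof. by move=> df dg; apply: deriveM; exact: diff_derivable. Qed.

Lemma derive_scale (c : R) f p v : differentiable f p ->
  'D_v (fun x => c * f x) p = c * 'D_v f p.
Proof.
move=> df; rewrite (@derive_mul (cst c))//.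
by rewrite derive_cst mulr0 addr0.
Qed.

Lemma derive_sqr f p v : differentiable f p ->
  'D_v (fun x => f x ^+ 2) p = 2 * f p * 'D_v f p.
Proof. by move=> df; rewrite derive_mul//; ring. Qed.

Lemma derive_bigsum n (F : 'I_n -> V -> R) p v :
  (forall i, differentiable (F i) p) ->
  'D_v (fun x => \sum_(i < n) F i x) p = \sum_(i < n) 'D_v (F i) p.
Proof.
move=> dF; rewrite -derive_sum; last by move=> i; exact: diff_derivable.
by congr ('D_v _ p); apply/funext => x; rewrite fct_sumE.
Qed.

(** The factor 1 / |grad u| of the unit normal has this form. *)
Lemma derive_inv_sqrt f p v : differentiable f p -> 0 < f p ->
  'D_v (fun x => (Num.sqrt (f x))^-1) p =
  - 2^-1 * (Num.sqrt (f p))^-1 ^+ 3 * 'D_v f p.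
Proof.
move=> df f0; have [ds s'] := is_derive1_sqrt f0.
have s0 : Num.sqrt (f p) != 0 by rewrite sqrtr_eq0 -ltNge.
have dsf : differentiable (Num.sqrt \o f) p.
  by apply: differentiable_comp => //; exact/derivable1_diffP.
have dsf' : derivable (Num.sqrt \o f) p v by exact: diff_derivable.
rewrite (@deriveV _ _ (Num.sqrt \o f) _ _ s0 dsf').
rewrite (derive_comp_real _ df ds) derive1E s' /GRing.scale/=.
by move: ('D_v f p) => D; field.
Qed.

End derive_rules.

(** * Lebesgue measure on row vectors and the divergence theorem *)

Section measure_rV.
Variable R : realType.
Local Notation lambda n := (lebesgue_rV R n).

Lemma rV_normP n (x : 'rV[R]_n) (M : R) : 0 <= M ->
  `|x| <= M <-> forall i, `|x ord0 i| <= M.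
Proof.
move=> M0; rewrite [`|x|]mx_normrE; split.
  by move=> /bigmax_leP[_ xM] i; exact: (xM (ord0, i)).
by move=> xM; apply/bigmax_leP; split=> // -[i j] _ /=; rewrite ord1.
Qed.

Lemma measurable_rV_box n (A : 'I_n -> set R) :
  (forall i, measurable (A i : set (measurableTypeR R))) ->
  measurable [set x : 'rV[R]_n | forall i, A i (x ord0 i)].
Proof.
move=> mA; rewrite [X in measurable X](_ : _ = \big[setI/setT]_(i < n)
    ([set: _] `&` (@rV_coord R n i @^-1` A i))).
  by apply: bigsetI_measurable => i _; exact: measurable_rV_coord.
apply/seteqP; split => v; rewrite -bigcap_seq => /= Av.
  by move=> i _; split => //; exact: Av.
by move=> i; have [] := Av i (mem_index_enum _).
Qed.

(** The sigma-algebra is generated by the coordinates, and an open set is the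
    countable union of the boxes with rational centre and radius 1/(k+1) that it
    contains. *)
Lemma measurable_rV_open n (U : set 'rV[R]_n) : open U -> measurable U.
Proof.
move=> oU.
pose B (p : 'rV[rat]_n * nat) := [set x : 'rV[R]_n |
  forall i, ball (ratr (p.1 ord0 i) : R) p.2.+1%:R^-1 (x ord0 i)].
have -> : U = \bigcup_p (if `[< B p `<=` U >] then B p else set0).
  apply/seteqP; split => [x Ux|x [p _]]; last by case: asboolP => // BU /BU.
  have /nbhs_ballP[e /= e0 eU] : nbhs x U by exact: open_nbhs_nbhs.
  (* Two balls of radius 1/(k+1) fit in the ball of radius e around x. *)
  pose k := (Num.truncn (2 / e)).
  have k0 : 0 < k.+1%:R^-1 :> R by rewrite invr_gt0.
  have ke : k.+1%:R^-1 * 2 <= e.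
    rewrite mulrC ler_pdivrMr// mulrC -ler_pdivrMr//.
    by apply/ltW; rewrite truncnS_gt.
  have itvk (a : R) : a - k.+1%:R^-1 < a + k.+1%:R^-1.
    by rewrite ltrD2l gtrN.
  have /choice[q qP] i : exists q : rat, ball (x ord0 i) k.+1%:R^-1 (ratr q : R).
    have [q] := @rat_in_itvoo R (x ord0 i - k.+1%:R^-1) (x ord0 i + k.+1%:R^-1)
      (itvk _).
    rewrite in_itv/= => /andP[q1 q2]; exists q.
    by rewrite /ball/= ltr_distlC; apply/andP; split.
  exists (\row_i q i, k) => //; case: asboolP => [_ i /=|].
    by rewrite mxE; exact/ball_sym/qP.
  case => y /= By; apply: eU.
  rewrite /ball/=; split => // a i; have -> : a = ord0 by rewrite ord1.
  apply: (le_ball ke); rewrite mulr2n mulrDr mulr1.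
  have := By i; rewrite mxE.
  exact: ball_triangle (qP i).
apply: countable_bigcupT_measurable => [|p].
  exact: countableP.
case: asboolP => // _.
apply: (@measurable_rV_box _ (fun i => ball (ratr (p.1 ord0 i) : R) p.2.+1%:R^-1)).
by move=> i; exact: measurable_ball.
Qed.

Lemma continuous_measurable_rV n (D : set 'rV[R]_n) (f : 'rV[R]_n -> R) :
  open D -> (forall x, D x -> {for x, continuous f}) -> measurable_fun D f.
Proof.
move=> oD cf; apply: (measurability _ (RGenOInfty.measurableE R)).
move=> _ [_ [a ->] <-]; apply: measurable_rV_open.
rewrite openE => x [Dx /=]; rewrite in_itv/= andbT => ax.
rewrite /interior; near=> y; split.
  by near: y; exact: open_near oD Dx.
rewrite /= in_itv/= andbT; near: y.
exact: (cvgr_gt (f x) (cf x Dx)).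
Unshelve. all: by end_near. Qed.

Definition cube n (M : R) := [set x : 'rV[R]_n | forall i, `[- M, M]%classic (x ord0 i)].

Lemma cubeP n M (x : 'rV[R]_n) : 0 <= M -> cube M x <-> `|x| <= M.
Proof.
move=> M0; rewrite rV_normP//; split => xM i; have := xM i;
  by rewrite /= in_itv/= ler_norml.
Qed.

Lemma measurable_cube n M : measurable (@cube n M).
Proof. by apply: (@measurable_rV_box _ (fun=> `[- M, M]%classic)) => i. Qed.

Lemma lebesgue_cube_lty n M : (lambda n (@cube n M) < +oo)%E.
Proof.
have -> : lambda n (@cube n M) =
    (\prod_(i < n) @lebesgue_measure R `[(- M)%R, M]%classic)%E.
  by rewrite -lebesgue_rV_box.
rewrite big_const_ord; elim: n => [|n IH] /=; first by rewrite ltry.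
rewrite lte_mul_pinfty// ?measure_ge0// ge0_fin_numE ?measure_ge0//.
by rewrite lebesgue_measure_itv/=; case: ifP => _; rewrite ?ltry// -EFinD ltry.
Qed.

Lemma compact_cube n M : compact (@cube n M).
Proof.
by apply: (@rV_compact R n (fun=> `[- M, M]%classic)) => i; exact: segment_compact.
Qed.

Lemma integrable_bounded_support n (f : 'rV[R]_n -> R) M (D : set 'rV[R]_n) :
  continuous f -> (forall x, M < `|x| -> f x = 0) -> measurable D ->
  (lambda n).-integrable D (EFin \o f).
Proof.
move=> cf f0 mD; apply: (@integrableS _ _ _ _ setT) => //.
pose K := Num.max M 0.
have K0 : 0 <= K by rewrite le_max lexx orbT.
have -> : EFin \o f = (EFin \o f) \_ (@cube n K).
  apply/funext => x; rewrite patchE; case: ifPn => // /negP xK /=.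
  rewrite f0//; rewrite ltNge; apply/negP => xM; apply: xK; rewrite inE.
  by apply/cubeP => //; rewrite le_max xM.
apply/(integrable_mkcond _ (measurable_cube K)).
apply: measurable_bounded_integrable.
- exact: measurable_cube.
- exact: lebesgue_cube_lty.
- apply: measurable_funTS.
  by apply: continuous_measurable_rV => [|x _]; [exact: openT|exact: cf].
- have /compact_bounded[N [Nr fN]] : compact (f @` @cube n K).
    apply: continuous_compact; last exact: compact_cube.
    exact: continuous_subspaceT.
  by exists N; split=> // N' NN' x Kx; apply: fN => //; exists x.
Qed.

Lemma integral_derive1_support (f : R -> R) M : 0 <= M ->
  (forall x, derivable f x 1) -> continuous (derive1 f) ->
  (forall x, M < `|x| -> f x = 0) ->
  (\int[@lebesgue_measure R]_x (derive1 f x)%:E = 0)%E.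
Proof.
move=> M0 df cdf f0.
have cf : continuous f.
  by move=> x; apply/differentiable_continuous/derivable1_diffP.
have f'0 x : M < `|x| -> derive1 f x = 0.
  move=> Mx; rewrite derive1E.
  rewrite (@eq_on_derive _ _ [set y : R | M < `|y|] f (cst 0)) ?derive_cst//.
  apply: (@open_comp _ _ (fun y : R => `|y|) [set z | M < z]) => [y _|].
    exact: norm_continuous.
  exact: open_gt.
have -> : (fun x => (derive1 f x)%:E) =
    (fun x => (derive1 f x)%:E) \_ `[- (M + 1), M + 1].
  apply/funext => x; rewrite patchE; case: ifPn => // /negP xM.
  rewrite f'0// ltNge; apply/negP => Mx; apply: xM; rewrite inE/= in_itv/=.
  by rewrite -ler_norml (le_trans Mx)// lerDl.
rewrite -integral_mkcond (continuous_FTC2 (F := f)).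
- by rewrite !f0 ?subee// ?normrN ger0_norm ?addr_ge0// ltrDl.
- by lra.
- exact: continuous_subspaceT.
- by split=> [x _||]; [exact: df|apply: cvg_at_right_filter; exact: cf|
    apply: cvg_at_left_filter; exact: cf].
- by [].
Qed.

Lemma rV_ext n (x y : 'rV[R]_n) : (forall i, x ord0 i = y ord0 i) -> x = y.
Proof. by move=> xy; apply/rowP => i; exact: xy. Qed.

Lemma rV_addZE n (h : R) (x y : 'rV[R]_n) i :
  (h *: x + y) ord0 i = h * x ord0 i + y ord0 i.
Proof. by rewrite !mxE. Qed.

Lemma ebaseE n (i j : 'I_n) : ebase R i ord0 j = (j == i)%:R.
Proof. by rewrite mxE eqxx. Qed.

Lemma rV_cons_shift0 n (h a : R) (v : 'rV[R]_n) :
  rV_cons (h *: 1 + a, v) = h *: ebase R ord0 + rV_cons (a, v).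
Proof.
apply: rV_ext => i; rewrite rV_addZE ebaseE.
case: (unliftP ord0 i) => [j|] ->.
  by rewrite !rV_consS/= mulr0 add0r.
by rewrite !rV_cons0/=.
Qed.

Lemma rV_cons_shiftS n (j : 'I_n) (h a : R) (v : 'rV[R]_n) :
  rV_cons (a, h *: ebase R j + v) = h *: ebase R (lift ord0 j) + rV_cons (a, v).
Proof.
apply: rV_ext => i; rewrite rV_addZE ebaseE.
case: (unliftP ord0 i) => [k|] ->.
  by rewrite !rV_consS/= rV_addZE ebaseE (inj_eq (@lift_inj _ ord0)).
by rewrite !rV_cons0/= mulr0 add0r.
Qed.

Lemma continuous_rV_cons2 n (a : R) : continuous (fun v : 'rV[R]_n => rV_cons (a, v)).
Proof.
move=> v A /nbhs_ballP[e /= e0 eA].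
apply: (@filterS _ _ (nbhs_filter v) _ _ _ (nbhsx_ballx v e e0)) => w vw.
apply: eA.
split=> // k i; have -> : k = ord0 by rewrite ord1.
case: (unliftP ord0 i) => [j|] ->; first by rewrite !rV_consS; exact: vw.2.
by rewrite !rV_cons0; exact: ballxx.
Qed.

Lemma continuous_rV_cons1 n (v : 'rV[R]_n) : continuous (fun a : R => rV_cons (a, v)).
Proof.
move=> a A /nbhs_ballP[e /= e0 eA].
apply: (@filterS _ _ (nbhs_filter a) _ _ _ (nbhsx_ballx a e e0)) => b ab.
apply: eA.
split=> // k i; have -> : k = ord0 by rewrite ord1.
case: (unliftP ord0 i) => [j|] ->; last by rewrite !rV_cons0.
by rewrite !rV_consS; exact: ballxx.
Qed.

Lemma continuous_slices n (f : 'rV[R]_n.+1 -> R) : continuous f ->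
  (forall v, continuous (fun a : R => f (rV_cons (a, v)))) /\
  (forall a, continuous (fun v : 'rV[R]_n => f (rV_cons (a, v)))).
Proof.
move=> cf; split=> [v a|a v].
  apply: (@continuous_comp _ _ _ (fun a : R => rV_cons (a, v)) f) (cf _).
  exact: continuous_rV_cons1.
apply: (@continuous_comp _ _ _ (fun v : 'rV[R]_n => rV_cons (a, v)) f) (cf _).
exact: continuous_rV_cons2.
Qed.

Lemma ler_norm_rV_cons n (a : R) (v : 'rV[R]_n) :
  `|a| <= `|rV_cons (a, v)| /\ `|v| <= `|rV_cons (a, v)|.
Proof.
have /(rV_normP _ (normr_ge0 _)).1 cv := lexx `|rV_cons (a, v)|; split.
  by have := cv ord0; rewrite rV_cons0.
by apply/rV_normP => // i; have := cv (lift ord0 i); rewrite rV_consS.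
Qed.

(** The Lebesgue measure in dimension n + 1 is the image of a product measure;
    this moves an integral to the product, where Fubini applies. *)
Lemma integral_rV_step n (f : 'rV[R]_n.+1 -> \bar R) :
  (lambda n.+1).-integrable setT f ->
  (@lebesgue_measure R \x lambda n)%E.-integrable setT (f \o @rV_cons R n) /\
  (\int[lambda n.+1]_x f x =
   \int[(@lebesgue_measure R \x lambda n)%E]_p f (rV_cons p))%E.
Proof.
move=> /integrableP[mf fi].
have mfc : measurable_fun setT (f \o @rV_cons R n).
  by apply: measurableT_comp mf _; exact: measurable_rV_cons.
have fci : (@lebesgue_measure R \x lambda n)%E.-integrable setT (f \o @rV_cons R n).
  apply/integrableP; split => //; move: fi.
  by rewrite ge0_integral_pushforward//=; first exact: measurable_rV_cons;
    exact: measurableT_comp.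
split=> //.
apply: etrans (integral_pushforward (@measurable_rV_cons R n) mf _ measurableT) _.
  by rewrite preimage_setT.
by rewrite preimage_setT.
Qed.

(** Divergence theorem for compact support, by induction on the dimension.  In
    the direction of the first coordinate the inner integral vanishes by the
    fundamental theorem of calculus; in any other direction the integral over the
    remaining coordinates vanishes by induction. *)
Lemma integral_partial_support n (i : 'I_n) (f : 'rV[R]_n -> R) M : 0 <= M ->
  continuous f -> (forall x, derivable f x (ebase R i)) ->
  continuous ('D_(ebase R i) f) -> (forall x, M < `|x| -> f x = 0) ->
  (\int[lambda n]_x ('D_(ebase R i) f x)%:E = 0)%E.
Proof.
move=> M0; elim: n i f => [[]//|n IH] i f cf df cdf f0.
have f'0 x : M < `|x| -> 'D_(ebase R i) f x = 0.
  move=> Mx.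
  rewrite (@eq_on_derive _ _ [set y | M < `|y|] f (cst 0)) ?derive_cst//.
  apply: (@open_comp _ _ (fun y : 'rV[R]_n.+1 => `|y|) [set z | M < z]) => [y _|].
    exact: norm_continuous.
  exact: open_gt.
have [fci ->] := integral_rV_step (integrable_bounded_support cdf f'0 measurableT).
case: (unliftP ord0 i) => [j|] ij; subst i.
  rewrite -integral12_prod_meas1//= /fubini_F.
  under eq_integral => a _.
    rewrite [X in integral _ _ X](_ : _ =
      fun v => ('D_(ebase R j) (fun v => f (rV_cons (a, v))) v)%:E); last first.
      apply/funext => v; rewrite /derive/=.
      by under [in RHS]eq_fun do rewrite /= rV_cons_shiftS.
    rewrite IH; first over.
    - exact: (continuous_slices cf).2.
    - move=> v; have := df (rV_cons (a, v)); rewrite /derivable/=.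
      by under [in X in _ -> X]eq_fun do rewrite /= rV_cons_shiftS.
    - rewrite [X in continuous X](_ : _ =
        'D_(ebase R (lift ord0 j)) f \o (fun v => rV_cons (a, v))).
        exact: (continuous_slices cdf).2.
      apply/funext => v; rewrite /derive/=.
      by under [in LHS]eq_fun do rewrite /= rV_cons_shiftS.
    - by move=> v Mv; apply: f0; apply: (lt_le_trans Mv); have [] := ler_norm_rV_cons a v.
  by rewrite integral0.
rewrite -integral21_prod_meas1//= /fubini_G.
under eq_integral => v _.
  have Df : derive1 (fun a => f (rV_cons (a, v))) =
      'D_(ebase R ord0) f \o (fun a => rV_cons (a, v)).
    apply/funext => a; rewrite derive1E /derive/=.
    by under [in LHS]eq_fun do rewrite /= rV_cons_shift0.
  rewrite [X in integral _ _ X](_ : _ =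
      fun a => (derive1 (fun a => f (rV_cons (a, v))) a)%:E); last first.
    by rewrite Df.
  rewrite (@integral_derive1_support _ M)//; first over.
  - move=> a; have := df (rV_cons (a, v)); rewrite /derivable/=.
    by under [in X in _ -> X]eq_fun do rewrite /= rV_cons_shift0.
  - by rewrite Df; exact: (continuous_slices cdf).1.
  - by move=> a Ma; apply: f0; apply: (lt_le_trans Ma); have [] := ler_norm_rV_cons a v.
by rewrite integral0.
Qed.

End measure_rV.

(* Otherwise a failed comparison of two second derivatives unfolds both to
   limits of difference quotients. *)
Local Opaque derive.

(** * Curvature, energy density and the first variation identity *)

Section double_well.
Variable R : realType.

Lemma smooth_double_well : smooth_on [set: R] (@double_well R).
Proof.
have sid : smooth_on [set: R] id.
  by apply: (@smooth_on_linear _ _ _ idfun) => [|x]; [exact: openT|exact: cvg_id].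
have oT : open [set: R] by exact: openT.
rewrite /double_well; do ![apply: smooth_onM => //; try exact: smooth_on_cst;
  try apply: smooth_onX => //].
by apply: smooth_onB => //; exact: (@smooth_on_cst _ _ _ 1).
Qed.

End double_well.

(** The directions [d] are the coordinate vectors of R^N, or their images in
    R * R^N when the first factor is the parameter of a variation. *)
Section geometry.
Variables (R : realType) (V : normedModType R) (N : nat) (d : 'I_N -> V) (eps : R).
Implicit Types (f u : V -> R) (p v : V).

Definition gradsq u p : R := \sum_(j < N) 'D_(d j) u p * 'D_(d j) u p.

Definition gradnorm u p : R := Num.sqrt (gradsq u p).

Definition unormal u i p : R := (gradnorm u p)^-1 * 'D_(d i) u p.

Definition curv u p : R := \sum_(i < N) 'D_(d i) (unormal u i) p.

Definition dens u p : R := eps / 2 * gradnorm u p ^+ 2 + eps^-1 * double_well (u p).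

(** The i-th component of P grad f / |grad u|, with P the projection onto the
    tangent space of the level set of u. *)
Definition tflux u f i p : R :=
  (gradnorm u p)^-1 * ('D_(d i) f p -
    unormal u i p * \sum_(j < N) unormal u j p * 'D_(d j) f p).

Variables (A : set V) (u : V -> R).
Hypotheses (oA : open A) (su : smooth_on A u)
  (u0 : forall p, A p -> 0 < gradsq u p).

Lemma smooth_gradsq : smooth_on A (gradsq u).
Proof.
by apply: smooth_on_sum => // j; apply: smooth_onM => //; exact: smooth_on_derive.
Qed.

Lemma smooth_gradnorm : smooth_on A (gradnorm u).
Proof. by apply: smooth_on_sqrt => //; exact: smooth_gradsq. Qed.

Lemma gradnorm_neq0 p : A p -> gradnorm u p != 0.
Proof. by move=> Ap; rewrite sqrtr_eq0 -ltNge u0. Qed.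

Lemma smooth_gradnormV : smooth_on A (fun p => (gradnorm u p)^-1).
Proof. by apply: smooth_onV => //; [exact: gradnorm_neq0|exact: smooth_gradnorm]. Qed.

Lemma smooth_normal i : smooth_on A (unormal u i).
Proof.
by apply: smooth_onM => //; [exact: smooth_gradnormV|exact: smooth_on_derive].
Qed.

Lemma smooth_curv : smooth_on A (curv u).
Proof.
by apply: smooth_on_sum => // i; apply: smooth_on_derive; exact: smooth_normal.
Qed.

Lemma smooth_dens : smooth_on A (dens u).
Proof.
apply: smooth_onD => //; apply: smooth_onZ => //.
  by apply: smooth_onX => //; exact: smooth_gradnorm.
exact: (smooth_on_comp oA (@smooth_double_well R) su).
Qed.

Lemma smooth_tflux f i : smooth_on A f -> smooth_on A (tflux u f i).
Proof.
move=> sf; apply: smooth_onM => //; first exact: smooth_gradnormV.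
apply: smooth_onB => //; first exact: smooth_on_derive.
apply: smooth_onM => //; first exact: smooth_normal.
apply: smooth_on_sum => // j; apply: smooth_onM => //; first exact: smooth_normal.
exact: smooth_on_derive.
Qed.

Lemma derive_gradsq v p : A p ->
  'D_v (gradsq u) p = 2 * \sum_(j < N) 'D_(d j) u p * 'D_(d j) ('D_v u) p.
Proof.
move=> Ap; have dDu j : differentiable ('D_(d j) u) p.
  by apply: smooth_on_differentiable Ap; exact: smooth_on_derive.
rewrite derive_bigsum; last by move=> j; exact: differentiableM.
rewrite mulr_sumr; apply: eq_bigr => j _.
rewrite (derive_mul _ (dDu j) (dDu j)) (smooth_schwarz v (d j) oA su Ap).
ring.
Qed.

(** Varying u in the direction v changes the unit normal only tangentially. *)
Lemma derive_normal v i p : A p ->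
  'D_v (unormal u i) p = tflux u ('D_v u) i p.
Proof.
move=> Ap; have dD := smooth_on_differentiable (smooth_on_derive (d i) su) Ap.
rewrite (derive_mul _ (smooth_on_differentiable smooth_gradnormV Ap) dD).
rewrite (derive_inv_sqrt _ (smooth_on_differentiable smooth_gradsq Ap) (u0 Ap)).
rewrite derive_gradsq// (smooth_schwarz v (d i) oA su Ap) /tflux /unormal.
under [in RHS]eq_bigr do rewrite -mulrA.
by rewrite -mulr_sumr -/(gradnorm u p); field; exact: gradnorm_neq0.
Qed.

(** Commutation of derivatives makes the variation of K = div nu the divergence
    of the variation of nu. *)
Lemma derive_curv v p : A p ->
  'D_v (curv u) p = \sum_(i < N) 'D_(d i) (tflux u ('D_v u) i) p.
Proof.
move=> Ap; rewrite derive_bigsum => [|i]; last first.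
  by apply: smooth_on_differentiable Ap; apply: smooth_on_derive; exact: smooth_normal.
apply: eq_bigr => i _; rewrite (smooth_schwarz _ _ oA (smooth_normal i) Ap).
by apply: (eq_on_derive _ oA Ap) => q Aq; exact: derive_normal.
Qed.

Lemma derive_dens v p : A p ->
  'D_v (dens u) p = eps * \sum_(j < N) 'D_(d j) u p * 'D_(d j) ('D_v u) p +
    eps^-1 * (derive1 (@double_well R) (u p) * 'D_v u p).
Proof.
move=> Ap.
have ddw : differentiable (@double_well R) (u p).
  exact: smooth_double_well [::] _ _.
have du : differentiable u p by exact: smooth_on_differentiable su Ap.
have E q : A q -> dens u q = eps / 2 * gradsq u q + eps^-1 * double_well (u q).
  by move=> Aq; rewrite /dens sqr_sqrtr// ltW// u0.
rewrite (eq_on_derive _ oA Ap E).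
have dg : differentiable (gradsq u) p.
  by apply: smooth_on_differentiable Ap; exact: smooth_gradsq.
have dc : differentiable (fun q => double_well (u q)) p.
  exact: (@differentiable_comp _ _ _ _ u (@double_well R)).
have dZ (c : R) f : differentiable f p -> differentiable (fun q => c * f q) p.
  by move=> df; apply: differentiableM => //; exact: differentiable_cst.
rewrite (derive_add _ (dZ _ _ dg) (dZ _ _ dc)) (derive_scale _ _ dg).
rewrite (derive_scale _ _ dc) (derive_gradsq _ Ap).
rewrite (@derive_comp_real _ _ (@double_well R) u _ _ du) => [|]; last exact/derivable1_diffP.
by congr (_ + _); rewrite mulrA divfK// pnatr_eq0.
Qed.

Lemma derive_energy v p : A p ->
  'D_v (fun q => curv u q ^+ 2 * dens u q) p =
  2 * (curv u p * dens u p *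
    (\sum_(i < N) 'D_(d i) (tflux u ('D_v u) i) p)) +
  curv u p ^+ 2 *
   (eps * \sum_(j < N) 'D_(d j) u p * 'D_(d j) ('D_v u) p +
    eps^-1 * (derive1 (@double_well R) (u p) * 'D_v u p)).
Proof.
move=> Ap.
have dc : differentiable (curv u) p.
  by apply: smooth_on_differentiable Ap; exact: smooth_curv.
have dd := smooth_on_differentiable smooth_dens Ap.
have dcc : differentiable (fun q => curv u q ^+ 2) p := differentiableM dc dc.
rewrite (derive_mul _ dcc dd).
by rewrite (derive_sqr _ dc) (derive_curv _ Ap) (derive_dens _ Ap); ring.
Qed.

(** This is - eps times the right-hand side of the evolution equation, see
    [Bellettini_rhsE]. *)
Definition grad_density u p : R :=
  \sum_(i < N) 'D_(d i) (tflux u (fun q => curv u q * dens u q) i) p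
  - eps / 2 * (\sum_(i < N) 'D_(d i) (fun q => curv u q ^+ 2) p * 'D_(d i) u p)
  - eps / 2 * curv u p ^+ 2 * (\sum_(i < N) 'D_(d i) ('D_(d i) u) p)
  + (2 * eps)^-1 * curv u p ^+ 2 * derive1 (@double_well R) (u p).

(** The field whose divergence collects the integrations by parts of the first
    variation: K h tflux(f) - tflux(K h) f + (eps / 2) K^2 f grad u. *)
Definition boundary_field u f i p : R :=
  curv u p * dens u p * tflux u f i p -
  tflux u (fun q => curv u q * dens u q) i p * f p +
  eps / 2 * (curv u p ^+ 2 * 'D_(d i) u p) * f p.

Lemma smooth_grad_density : smooth_on A (grad_density u).
Proof.
have sK := smooth_curv; have sK2 := smooth_onX oA 2 sK.
have sk := smooth_onM oA sK smooth_dens.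
have sW : smooth_on A (fun p => derive1 (@double_well R) (u p)).
  have -> : (fun p => derive1 (@double_well R) (u p)) = 'D_1 (@double_well R) \o u.
    by apply/funext => p; rewrite /= derive1E.
  apply: smooth_on_comp => //.
  exact: smooth_on_derive (@smooth_double_well R).
apply: smooth_onD => //; last first.
  by apply: smooth_onM => //; apply: smooth_onZ.
apply: smooth_onB => //.
  apply: smooth_onB => //.
    by apply: smooth_on_sum => // i; apply: smooth_on_derive; exact: smooth_tflux.
  apply: smooth_onZ => //; apply: smooth_on_sum => // i.
  by apply: smooth_onM => //; exact: smooth_on_derive.
apply: smooth_onM => //; first exact: smooth_onZ.
by apply: smooth_on_sum => // i; do 2 apply: smooth_on_derive.
Qed.

Lemma smooth_boundary_field f i : smooth_on A f -> smooth_on A (boundary_field u f i).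
Proof.
move=> sf; have sK := smooth_curv; have sK2 := smooth_onX oA 2 sK.
have sk := smooth_onM oA sK smooth_dens.
have sf' : smooth_on A (tflux u f i) := smooth_tflux i sf.
have sk' := smooth_tflux i sk.
have su' := smooth_on_derive (d i) su.
apply: smooth_onD => //; first by apply: smooth_onB => //; exact: smooth_onM.
by apply: smooth_onM => //; apply: smooth_onZ => //; exact: smooth_onM.
Qed.

(** The tangential projection is symmetric. *)
Lemma tflux_sym f g p :
  \sum_(i < N) 'D_(d i) f p * tflux u g i p = \sum_(i < N) tflux u f i p * 'D_(d i) g p.
Proof.
rewrite /tflux.
transitivity ((gradnorm u p)^-1 * (\sum_(i < N) 'D_(d i) f p * 'D_(d i) g p -
   (\sum_(i < N) unormal u i p * 'D_(d i) f p) *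
   (\sum_(i < N) unormal u i p * 'D_(d i) g p))).
  rewrite mulr_suml -sumrB mulr_sumr; apply: eq_bigr => i _; ring.
rewrite mulr_sumr -sumrB mulr_sumr; apply: eq_bigr => i _; ring.
Qed.

(** The left-hand side is half of [derive_energy], with f in place of the
    derivative of u.  All terms with derivatives of f are absorbed in the
    divergence, through [tflux_sym] for the curvature part. *)
Lemma first_variation_divergence f p : smooth_on A f -> A p -> eps != 0 ->
  curv u p * dens u p * (\sum_(i < N) 'D_(d i) (tflux u f i) p) +
  curv u p ^+ 2 / 2 *
   (eps * (\sum_(j < N) 'D_(d j) u p * 'D_(d j) f p) +
    eps^-1 * (derive1 (@double_well R) (u p) * f p)) =
  grad_density u p * f p + \sum_(i < N) 'D_(d i) (boundary_field u f i) p.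
Proof.
move=> sf Ap e0.
pose k q := curv u q * dens u q.
have sk : smooth_on A k by apply: smooth_onM => //; [exact: smooth_curv|exact: smooth_dens].
have diff g : smooth_on A g -> differentiable g p.
  by move=> sg; exact: smooth_on_differentiable sg Ap.
have E i : 'D_(d i) (boundary_field u f i) p =
    k p * 'D_(d i) (tflux u f i) p + 'D_(d i) k p * tflux u f i p
    - tflux u k i p * 'D_(d i) f p - 'D_(d i) (tflux u k i) p * f p
    + eps / 2 * ('D_(d i) (fun q => curv u q ^+ 2) p * 'D_(d i) u p) * f p
    + eps / 2 * curv u p ^+ 2 * 'D_(d i) ('D_(d i) u) p * f p
    + eps / 2 * curv u p ^+ 2 * ('D_(d i) u p * 'D_(d i) f p).
  have s1 : smooth_on A (tflux u f i) by exact: smooth_tflux.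
  have s2 : smooth_on A (tflux u k i) by exact: smooth_tflux.
  have s3 : smooth_on A (fun q => curv u q ^+ 2).
    by apply: smooth_onX => //; exact: smooth_curv.
  have s4 : smooth_on A ('D_(d i) u) by exact: smooth_on_derive.
  have s5 := smooth_onM oA s3 s4.
  have s6 := smooth_onZ oA (eps / 2) s5.
  rewrite /boundary_field derive_add; last 2 first.
  - by apply: diff; apply: smooth_onB => //; exact: smooth_onM.
  - by apply: diff; apply: smooth_onM.
  rewrite derive_sub; last 2 first.
  - by apply: diff; exact: smooth_onM.
  - by apply: diff; exact: smooth_onM.
  rewrite (derive_mul _ (diff _ sk) (diff _ s1)).
  rewrite (derive_mul _ (diff _ s2) (diff _ sf)) (derive_mul _ (diff _ s6) (diff _ sf)).
  rewrite (derive_scale _ _ (diff _ s5)) (derive_mul _ (diff _ s3) (diff _ s4)).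
  move: ('D_(d i) (tflux u f i) p) (tflux u f i p) ('D_(d i) k p)
    ('D_(d i) (tflux u k i) p) (tflux u k i p) ('D_(d i) f p)
    ('D_(d i) (fun q => curv u q ^+ 2) p) ('D_(d i) ('D_(d i) u) p)
    ('D_(d i) u p) => x1 x2 x3 x4 x5 x6 x7 x8 x9.
  ring.
under [in RHS]eq_bigr do rewrite E.
rewrite !big_split/= !sumrN -!mulr_suml -!mulr_sumr tflux_sym.
rewrite /grad_density -/k -[curv u p * dens u p]/(k p).
have algebra (c w' z kp s1 s2 s3 s4 s5 s6 : R) :
    kp * s2 + c ^+ 2 / 2 * (eps * s4 + eps^-1 * (w' * z)) =
    (s1 - eps / 2 * s5 - eps / 2 * c ^+ 2 * s6 + (2 * eps)^-1 * c ^+ 2 * w') * z +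
    (kp * s2 + s3 - s3 - s1 * z + eps / 2 * s5 * z + eps / 2 * c ^+ 2 * s6 * z +
     eps / 2 * c ^+ 2 * s4) by field.
exact: algebra.
Qed.

End geometry.

Section locality.
Variables (R : realType) (V : normedModType R) (N : nat) (d : 'I_N -> V) (eps : R).
Variables (A : set V) (f g : V -> R).
Hypotheses (oA : open A) (fg : forall p, A p -> f p = g p).

Lemma eq_on_gradsq p : A p -> gradsq d f p = gradsq d g p.
Proof.
by move=> Ap; apply: eq_bigr => i _; rewrite !(eq_on_derive _ oA Ap fg).
Qed.

Lemma eq_on_normal i p : A p -> unormal d f i p = unormal d g i p.
Proof.
by move=> Ap; rewrite /unormal /gradnorm eq_on_gradsq// (eq_on_derive _ oA Ap fg).
Qed.

Lemma eq_on_curv p : A p -> curv d f p = curv d g p.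
Proof.
move=> Ap; apply: eq_bigr => i _; apply: (eq_on_derive _ oA Ap) => q Aq.
exact: eq_on_normal.
Qed.

Lemma eq_on_dens p : A p -> dens d eps f p = dens d eps g p.
Proof. by move=> Ap; rewrite /dens /gradnorm eq_on_gradsq// fg. Qed.

End locality.

Section coordinates.
Variables (R : realType) (N : nat).
Implicit Types (u f : 'rV[R]_N -> R) (x : 'rV[R]_N).
Local Notation e := (@ebase R N).

Lemma dotv_grad u f x :
  dotv (grad u x) (grad f x) = \sum_(j < N) 'D_(e j) u x * 'D_(e j) f x.
Proof. by apply: eq_bigr => j _; rewrite !mxE. Qed.

Lemma enorm_grad u x : enorm (grad u x) = gradnorm e u x.
Proof. by rewrite /enorm dotv_grad. Qed.

Lemma unit_normalE u x i : unit_normal u x ord0 i = unormal e u i x.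
Proof. by rewrite /unit_normal enorm_grad !mxE. Qed.

Lemma curvatureE u : curvature u = curv e u.
Proof.
apply/funext => x; apply: eq_bigr => i _; congr ('D_(e i) _ x).
by apply/funext => y; exact: unit_normalE.
Qed.

Lemma energy_densityE eps u : energy_density eps u = dens e eps u.
Proof. by apply/funext => x; rewrite /energy_density enorm_grad. Qed.

Lemma tangent_fluxE u f x i :
  mxapp (tangent_proj u x) ((enorm (grad u x))^-1 *: grad f x) ord0 i =
  tflux e u f i x.
Proof.
rewrite /mxapp mxE !mxE enorm_grad /tflux mulrBr mulr_sumr mulr_sumr.
rewrite [X in X - _](_ : _ =
  \sum_(j < N) (i == j)%:R * ((gradnorm e u x)^-1 * 'D_(e j) f x)); last first.
  rewrite (bigD1 i)//= eqxx mul1r big1 ?addr0// => j ji.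
  by rewrite eq_sym (negbTE ji) mul0r.
rewrite -sumrB; apply: eq_bigr => j _; rewrite !mxE enorm_grad /unormal.
ring.
Qed.

Lemma Bellettini_rhsE eps u x : eps != 0 ->
  - eps * Bellettini_rhs eps u x = grad_density e eps u x.
Proof.
move=> eps0; rewrite /Bellettini_rhs /grad_density curvatureE energy_densityE dotv_grad.
have -> : laplacian u x = \sum_(i < N) 'D_(e i) ('D_(e i) u) x.
  apply: eq_bigr => i _; congr ('D_(e i) _ x).
  by apply/funext => y; rewrite mxE.
have -> : divergence (fun y => mxapp (tangent_proj u y) ((enorm (grad u y))^-1 *:
      grad (fun z => curv e u z * dens e eps u z) y)) x =
    \sum_(i < N) 'D_(e i) (tflux e u (fun q => curv e u q * dens e eps u q) i) x.
  apply: eq_bigr => i _; congr ('D_(e i) _ x).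
  by apply/funext => y; exact: tangent_fluxE.
have algebra (c l w' s1 s2 : R) :
    - eps * (c ^+ 2 / 2 * (l - (eps ^+ 2)^-1 * w') + 2^-1 * s1 - eps^-1 * s2) =
    s2 - eps / 2 * s1 - eps / 2 * c ^+ 2 * l + (2 * eps)^-1 * c ^+ 2 * w' by field.
exact: algebra.
Qed.

Lemma gradsq_gt0 u x : grad u x != 0 -> 0 < gradsq e u x.
Proof.
apply: contraNT; rewrite -leNgt => le0; apply/eqP/rowP => i; rewrite !mxE.
have ge0 j : true -> 0 <= 'D_(e j) u x * 'D_(e j) u x by rewrite -expr2 sqr_ge0.
have /eqP : gradsq e u x = 0.
  by apply/eqP; rewrite eq_le le0 sumr_ge0.
rewrite psumr_eq0// => /allP /(_ i (mem_index_enum _)) /=.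
by rewrite mulf_eq0 orbb => /eqP.
Qed.

End coordinates.

Section slices.
Variables (R : realType) (W : normedModType R) (N : nat) (d : 'I_N -> W).
Implicit Types (U F : (R * W)%type -> R) (s : R) (x : W).
Local Notation d' := (fun i => ((0 : R), d i)).

Lemma gradsq_slice U s x : gradsq d' U (s, x) = gradsq d (fun y => U (s, y)) x.
Proof. by apply: eq_bigr => j _; rewrite !derive_slice. Qed.

Lemma normal_slice U i s x :
  unormal d' U i (s, x) = unormal d (fun y => U (s, y)) i x.
Proof. by rewrite /unormal /gradnorm gradsq_slice derive_slice. Qed.

Lemma curv_slice U s x : curv d' U (s, x) = curv d (fun y => U (s, y)) x.
Proof.
apply: eq_bigr => i _; rewrite -derive_slice; congr ('D_(d i) _ x).
by apply/funext => y; exact: normal_slice.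
Qed.

Lemma dens_slice eps U s x :
  dens d' eps U (s, x) = dens d eps (fun y => U (s, y)) x.
Proof. by rewrite /dens /gradnorm gradsq_slice. Qed.

Lemma tflux_slice U F i s x :
  tflux d' U F i (s, x) = tflux d (fun y => U (s, y)) (fun y => F (s, y)) i x.
Proof.
rewrite /tflux /gradnorm gradsq_slice normal_slice -derive_slice; congr (_ * (_ - _ * _)).
by apply: eq_bigr => j _; rewrite normal_slice -derive_slice.
Qed.

End slices.

(** * Test functions *)

Section test_functions.
Variables (R : realType) (N : nat) (Omega : set 'rV[R]_N).
Hypothesis oO : open Omega.
Implicit Types (w g : 'rV[R]_N -> R) (x v : 'rV[R]_N).
Local Notation lambda := (lebesgue_rV R N).

Definition supp w := closure [set x | w x != 0].

Lemma open_suppC w : open (~` supp w).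
Proof. by apply: closed_openC; exact: closed_closure. Qed.

Lemma suppC0 w x : ~ supp w x -> w x = 0.
Proof.
move=> nwx; apply/eqP; apply: contra_notT nwx => wx0.
exact: subset_closure.
Qed.

Lemma derive_suppC w v x : ~ supp w x -> 'D_v w x = 0.
Proof.
move=> nwx; rewrite (eq_on_derive v (@open_suppC w) nwx (g := cst 0)).
  by rewrite derive_cst.
by move=> y; exact: suppC0.
Qed.

(** A function which is smooth on Omega and vanishes off the support of a test
    function is a test function: it is smooth on Omega and on the complement of
    that support, which cover the space. *)
Lemma test_of_smooth w g : test_function Omega w -> smooth_on Omega g ->
  (forall x, ~ supp w x -> g x = 0) -> test_function Omega g.
Proof.
move=> [sw cw wO] sg g0.
have gw : supp g `<=` supp w.
  have -> : supp w = closure (supp w) by apply/closure_id; exact: closed_closure.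
  apply: closure_subset => x /= gx; apply: contrapT => nwx.
  by move: gx; rewrite g0// eqxx.
split; last exact: subset_trans gw wO.
  rewrite (_ : setT = Omega `|` ~` supp w).
    apply: smooth_onU => //.
    apply: (@smooth_on_ext _ _ _ (cst 0)); first exact: open_suppC.
      by move=> x nwx; rewrite g0.
    by apply: smooth_on_cst; exact: open_suppC.
  apply/seteqP; split=> // x _; have [|] := pselect (supp w x); last by right.
  by move=> /wO; left.
exact: subclosed_compact (@closed_closure _ _) cw gw.
Qed.

Lemma test_mul w g : test_function Omega w -> smooth_on Omega g ->
  test_function Omega (fun x => g x * w x).
Proof.
move=> tw sg; apply: (test_of_smooth tw) => [|x nwx].
  by apply: smooth_onM => //; case: tw => sw _ _; exact: smooth_onS sw.
by rewrite (suppC0 nwx) mulr0.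
Qed.

Lemma test_smooth w : test_function Omega w -> smooth_on Omega w.
Proof. by case=> sw _ _; exact: smooth_onS sw. Qed.

Lemma compact_cube_sub (C : set 'rV[R]_N) : compact C ->
  exists2 M, 0 <= M & C `<=` cube M.
Proof.
move=> /compact_bounded[M [_ CM]]; exists (`|M| + 1); first by rewrite addr_ge0.
move=> x Cx; apply/cubeP; first by rewrite addr_ge0.
by apply: CM => //; rewrite ltr_pwDr// ler_norm.
Qed.

Lemma test_bounded_support w : test_function Omega w ->
  exists2 M, 0 <= M & forall x, M < `|x| -> ~ supp w x.
Proof.
move=> [_ /compact_cube_sub[M M0 wM] _]; exists M => // x Mx /wM.
by move/(cubeP _ M0); rewrite leNgt Mx.
Qed.

Lemma test_integrable w : test_function Omega w ->
  lambda.-integrable Omega (EFin \o w).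
Proof.
move=> tw; have [M M0 wM] := test_bounded_support tw.
apply: (@integrable_bounded_support _ _ _ M); last exact: measurable_rV_open.
  by move=> x; case: tw => sw _ _; exact: smooth_on_continuous sw I.
by move=> x /wM; exact: suppC0.
Qed.

Lemma test_derive w v : test_function Omega w -> test_function Omega ('D_v w).
Proof.
move=> tw; apply: (test_of_smooth tw); last by move=> x; exact: derive_suppC.
by apply: smooth_on_derive; exact: test_smooth.
Qed.

Lemma integral_test_partial w i : test_function Omega w ->
  (\int[lambda]_(x in Omega) ('D_(ebase R i) w x)%:E = 0)%E.
Proof.
move=> tw; have [M M0 wM] := test_bounded_support tw.
have [sw _ wO] := tw.
rewrite integral_mkcond [X in integral _ _ X](_ : _ = fun x => ('D_(ebase R i) w x)%:E).
  apply: (integral_partial_support M0).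
  - by move=> x; exact: smooth_on_continuous sw I.
  - by move=> x; apply: diff_derivable; exact: smooth_on_differentiable sw I.
  - by move=> x; apply: smooth_on_continuous (smooth_on_derive _ sw) I.
  - by move=> x /wM; exact: suppC0.
apply/funext => x; rewrite patchE; case: ifPn => // xO.
by rewrite derive_suppC// => /wO Ox; move/negP: xO; rewrite inE.
Qed.

End test_functions.

(** * First variation of the energy *)

Section perturbation.
Variables (R : realType) (N : nat) (Omega : set 'rV[R]_N) (eps : R).
Variables (u w : 'rV[R]_N -> R).
Hypotheses (oO : open Omega) (eps0 : 0 < eps) (su : smooth_on Omega u)
  (u0 : forall x, Omega x -> 0 < gradsq (@ebase R N) u x)
  (tw : test_function Omega w).
Local Notation lambda := (lebesgue_rV R N).
Local Notation e := (@ebase R N).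
Local Notation V := (R * 'rV[R]_N)%type.

(** With (s, x) as one variable, the integrand of the energy of u + s w is a
    smooth function on an open set of R * R^N. *)
Definition perturb (p : V) : R := u p.2 + p.1 * w p.2.

Definition spatial (i : 'I_N) : V := (0, e i).

Definition perturb_dom : set V :=
  [set p | Omega p.2 /\ 0 < gradsq spatial perturb p].

Definition perturb_energy (p : V) : R :=
  curv spatial perturb p ^+ 2 * dens spatial eps perturb p.

Lemma perturb_energyE s x : perturb_energy (s, x) =
  curvature (fun y => u y + s * w y) x ^+ 2 *
  energy_density eps (fun y => u y + s * w y) x.
Proof.
by rewrite /perturb_energy curv_slice dens_slice curvatureE energy_densityE.
Qed.

Let cylinder : set V := [set p | Omega p.2].

Let open_cylinder : open cylinder.
Proof.
by apply: (@open_comp _ _ snd) => // p _; exact: cvg_snd.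
Qed.

Lemma smooth_perturb : smooth_on cylinder perturb.
Proof.
apply: smooth_onD => //; first exact: smooth_on_snd.
apply: smooth_onM => //; first exact: smooth_on_fst.
by apply: smooth_on_snd; exact: test_smooth.
Qed.

Lemma open_perturb_dom : open perturb_dom.
Proof.
rewrite openE => p [Op gp]; rewrite /interior.
have cg : {for p, continuous (gradsq spatial perturb)}.
  by apply: smooth_on_continuous (smooth_gradsq spatial open_cylinder smooth_perturb) _.
have n1 : nbhs p cylinder by exact: open_nbhs_nbhs.
have n2 : nbhs p [set q | 0 < gradsq spatial perturb q] by exact: (cvgr_gt _ cg).
exact: filterI n1 n2.
Qed.

Let smooth_perturb_dom : smooth_on perturb_dom perturb.
Proof. by apply: smooth_onS smooth_perturb => p []. Qed.

Lemma smooth_perturb_energy : smooth_on perturb_dom perturb_energy.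
Proof.
have pos p : perturb_dom p -> 0 < gradsq spatial perturb p by case.
apply: smooth_onM; first exact: open_perturb_dom.
  apply: smooth_onX; first exact: open_perturb_dom.
  exact: smooth_curv open_perturb_dom smooth_perturb_dom pos.
exact: smooth_dens open_perturb_dom smooth_perturb_dom pos.
Qed.

Lemma perturb0 : (fun y => perturb (0, y)) = u.
Proof. by apply/funext => y; rewrite /perturb/= mul0r addr0. Qed.

Lemma perturb_suppC s x : ~ supp w x -> perturb (s, x) = u x.
Proof. by move=> nwx; rewrite /perturb/= (suppC0 nwx) mulr0 addr0. Qed.

(** Near a point outside the support of w the variation does not move u. *)
Lemma perturb_energy_suppC s x : ~ supp w x ->
  perturb_energy (s, x) = perturb_energy (0, x).
Proof.
move=> nwx; rewrite /perturb_energy !curv_slice !dens_slice.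
have E y : (~` supp w) y -> perturb (s, y) = perturb (0, y).
  by move=> nwy; rewrite !perturb_suppC.
by rewrite (eq_on_curv e (@open_suppC _ _ w) E nwx)
  (eq_on_dens e eps (@open_suppC _ _ w) E nwx).
Qed.

Lemma perturb_dom0 x : Omega x -> perturb_dom (0, x).
Proof. by move=> Ox; split => //; rewrite gradsq_slice perturb0; exact: u0. Qed.

(** The support of w is compact and the domain is an open neighbourhood of
    {0} x supp w, so it contains a tube around it; elsewhere u + s w = u. *)
Lemma perturb_dom_near0 :
  exists2 r : R, 0 < r & forall s x, `|s| <= r -> Omega x -> perturb_dom (s, x).
Proof.
have [_ /compact_near_coveringP cov wO] := tw.
have {}cov := cov _ (nbhs (0 : R)) (fun s x => perturb_dom (s, x)) _.
have /nbhs_ballP[r /= r0 rD] :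
    \forall s \near (0 : R), supp w `<=` (fun x => perturb_dom (s, x)).
  apply: cov => x /wO Ox.
  have [[P Q] /= [nP nQ] PQ] : nbhs ((0 : R), x) perturb_dom.
    by apply: open_nbhs_nbhs; split; [exact: open_perturb_dom|exact: perturb_dom0].
  by exists (Q, P) => // -[y s] /= [Qy Ps]; exact: (PQ (s, y)).
exists (r / 2) => [|s x sr Ox]; first by rewrite divr_gt0.
have [wx|nwx] := pselect (supp w x).
  apply: rD wx; rewrite /ball/= sub0r normrN (le_lt_trans sr)//.
  by rewrite ltr_pdivrMr// ltr_pMr// ltr1n.
split => //; rewrite gradsq_slice.
rewrite (eq_on_gradsq e (@open_suppC _ _ w) (g := u) _ nwx); first exact: u0.
by move=> y; exact: perturb_suppC.
Qed.

Lemma derive_perturb : 'D_((1 : R), (0 : 'rV[R]_N)) perturb = fun p => w p.2.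
Proof.
apply/funext => -[s x]; rewrite -derive1_slice derive1E /perturb/=.
have -> : (fun t : R => u x + t * w x) = (fun t => cst (u x) t + w x * id t).
  by apply/funext => t; rewrite mulrC.
have dm : differentiable (fun t : R => w x * id t) s.
  by apply: (@differentiableM _ _ (cst (w x)) id).
rewrite (derive_add _ (differentiable_cst _ _) dm) derive_cst derive_scale//.
by rewrite derive_id mulr1 add0r.
Qed.

Lemma derive_perturb_energy x : Omega x ->
  'D_((1 : R), (0 : 'rV[R]_N)) perturb_energy (0, x) =
  2 * (grad_density e eps u x * w x +
       \sum_(i < N) 'D_(e i) (boundary_field e eps u w i) x).
Proof.
move=> Ox; have sw := test_smooth tw.
rewrite -(first_variation_divergence oO su u0 sw Ox (lt0r_neq0 eps0)).
have pos p : perturb_dom p -> 0 < gradsq spatial perturb p by case.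
rewrite (derive_energy eps open_perturb_dom smooth_perturb_dom pos _ (perturb_dom0 Ox)).
have Dw : 'D_((1 : R), (0 : 'rV[R]_N)) perturb (0, x) = w x.
  exact: (congr1 (@^~ (0, x)) derive_perturb).
rewrite Dw derive_perturb curv_slice dens_slice perturb0.
have -> : \sum_(i < N) 'D_(spatial i) (tflux spatial perturb (fun p => w p.2) i) (0, x) =
    \sum_(i < N) 'D_(e i) (tflux e u w i) x.
  apply: eq_bigr => i _; rewrite -derive_slice; congr ('D_(e i) _ x).
  by apply/funext => y; rewrite tflux_slice perturb0.
have -> : \sum_(j < N) 'D_(spatial j) perturb (0, x) *
      'D_(spatial j) (fun p => w p.2) (0, x) = \sum_(j < N) 'D_(e j) u x * 'D_(e j) w x.
  by apply: eq_bigr => j _; rewrite -!derive_slice perturb0.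
rewrite [perturb (0, x)](congr1 (@^~ x) perturb0) /=.
have algebra (k a c b : R) : 2 * (k * a) + c ^+ 2 * b = 2 * (k * a + c ^+ 2 / 2 * b).
  by field.
exact: algebra.
Qed.

Lemma smooth_perturb_slice r s :
  (forall s x, `|s| <= r -> Omega x -> perturb_dom (s, x)) -> `|s| <= r ->
  smooth_on Omega (fun x => perturb_energy (s, x)).
Proof.
move=> rD sr; apply: (@smooth_onS _ _ _ [set x | perturb_dom (s, x)]).
  by move=> x Ox; exact: rD.
by apply: smooth_on_slice; exact: smooth_perturb_energy.
Qed.

(** As a consequence the energy density of u + s w is integrable as soon as the
    one of u is. *)
Lemma test_perturb_diff r s :
  (forall s x, `|s| <= r -> Omega x -> perturb_dom (s, x)) -> `|s| <= r ->
  test_function Omega (fun x => perturb_energy (s, x) - perturb_energy (0, x)).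
Proof.
move=> rD sr; have r0 : `|0 : R| <= r by rewrite normr0 (le_trans _ sr).
apply: (test_of_smooth tw) => [|x nwx].
  by apply: smooth_onB => //; apply: smooth_perturb_slice rD _.
by rewrite perturb_energy_suppC// subrr.
Qed.

Lemma perturb_energy_ge0 p : 0 <= perturb_energy p.
Proof.
apply: mulr_ge0; first exact: sqr_ge0.
apply: addr_ge0; apply: mulr_ge0; rewrite ?sqr_ge0//.
- by rewrite divr_ge0// ltW.
- by rewrite invr_ge0 ltW.
- by rewrite /double_well -mulrA mulr_ge0 ?invr_ge0// mulr_ge0// sqr_ge0.
Qed.

Lemma Bellettini_perturbE s :
  Bellettini_energy eps Omega (fun x => u x + s * w x) =
  ((2^-1)%:E * \int[lambda]_(x in Omega) (perturb_energy (s, x))%:E)%E.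
Proof.
by congr (_ * _)%E; apply: eq_integral => x _; rewrite perturb_energyE.
Qed.

Hypothesis finE : (Bellettini_energy eps Omega u < +oo)%E.

Lemma integrable_perturb0 :
  lambda.-integrable Omega (fun x => (perturb_energy (0, x))%:E).
Proof.
have [r r0 rD] := perturb_dom_near0.
apply/integrableP; split.
  apply/measurable_EFinP; apply: continuous_measurable_rV => // x Ox.
  have s0 : smooth_on Omega (fun x => perturb_energy (0, x)).
    by apply: smooth_perturb_slice rD _; rewrite normr0 ltW.
  exact: smooth_on_continuous s0 Ox.
rewrite (eq_integral (fun x => (perturb_energy (0, x))%:E)); last first.
  by move=> x _; rewrite gee0_abs// lee_fin perturb_energy_ge0.
have := finE; have := Bellettini_perturbE 0.
rewrite (_ : (fun x => u x + 0 * w x) = u); last first.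
  by apply/funext => x; rewrite mul0r addr0.
move=> ->; apply: contraTT; rewrite -!leNgt !leye_eq => /eqP ->.
by rewrite gt0_muley// lte_fin invr_gt0.
Qed.

Lemma integrable_perturb r s :
  (forall s x, `|s| <= r -> Omega x -> perturb_dom (s, x)) -> `|s| <= r ->
  lambda.-integrable Omega (fun x => (perturb_energy (s, x))%:E).
Proof.
move=> rD sr; have mO := measurable_rV_open oO.
have := integrableD mO integrable_perturb0 (test_integrable oO (test_perturb_diff rD sr)).
by apply: eq_integrable => // x _; rewrite /= -EFinD addrC subrK.
Qed.

Lemma integral_first_variation :
  [/\ lambda.-integrable Omega (fun x => (grad_density e eps u x * w x)%:E),
    lambda.-integrable Omega (fun x => (grad_density e eps u x * w x +
       \sum_(i < N) 'D_(e i) (boundary_field e eps u w i) x)%:E) &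
    (\int[lambda]_(x in Omega) (grad_density e eps u x * w x +
       \sum_(i < N) 'D_(e i) (boundary_field e eps u w i) x)%:E =
     \int[lambda]_(x in Omega) (grad_density e eps u x * w x)%:E)%E].
Proof.
have mO := measurable_rV_open oO; have sw := test_smooth tw.
have igw : lambda.-integrable Omega (fun x => (grad_density e eps u x * w x)%:E).
  by apply: (test_integrable oO); apply: test_mul => //; exact: smooth_grad_density.
have tT i : test_function Omega (boundary_field e eps u w i).
  apply: (test_of_smooth tw); first exact: smooth_boundary_field.
  move=> x nwx; rewrite /boundary_field /tflux (suppC0 nwx) (derive_suppC _ nwx) big1.
    by rewrite !(mulr0, subr0, addr0).
  by move=> j _; rewrite (derive_suppC _ nwx) mulr0.
have iT i : lambda.-integrable Omega (fun x => ('D_(e i) (boundary_field e eps u w i) x)%:E).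
  by apply: (test_integrable oO); exact: test_derive.
have iS : lambda.-integrable Omega (fun x =>
    (\sum_(i < N) ('D_(e i) (boundary_field e eps u w i) x)%:E)%E).
  exact: integrable_sum.
have E x : (grad_density e eps u x * w x +
       \sum_(i < N) 'D_(e i) (boundary_field e eps u w i) x)%:E =
    ((grad_density e eps u x * w x)%:E +
     \sum_(i < N) ('D_(e i) (boundary_field e eps u w i) x)%:E)%E.
  by rewrite EFinD sumEFin.
split=> //; first by under eq_fun do rewrite E; exact: integrableD.
under eq_integral do rewrite E.
rewrite integralD// integral_sum// big1 ?adde0// => i _.
exact: integral_test_partial.
Qed.

End perturbation.

Section gradient.
Variables (R : realType) (N : nat) (Omega : set 'rV[R]_N) (eps : R).
Variables (u w : 'rV[R]_N -> R).
Hypotheses (oO : open Omega) (bO : bounded_set Omega) (eps0 : 0 < eps)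
  (su : smooth_on Omega u)
  (u0 : forall x, Omega x -> 0 < gradsq (@ebase R N) u x)
  (tw : test_function Omega w)
  (finE : (Bellettini_energy eps Omega u < +oo)%E).
Local Notation lambda := (lebesgue_rV R N).
Local Notation en := (perturb_energy eps u w).
Local Notation D1 f := ('D_((1 : R), (0 : 'rV[R]_N)) f).

Lemma bounded_finite_measure : (lambda Omega < +oo)%E.
Proof.
have [M [_ OM]] := bO.
apply: le_lt_trans (lebesgue_cube_lty N (`|M| + 1)); apply: le_measure.
- by rewrite inE; exact: measurable_rV_open.
- by rewrite inE; exact: measurable_cube.
- move=> x Ox; apply/cubeP; first by rewrite addr_ge0.
  by apply: OM => //; rewrite ltr_pwDr// ler_norm.
Qed.

(** This bound dominates the difference quotients of the energy density. *)
Lemma perturb_derive_bound r :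
  (forall s x, `|s| <= r -> Omega x -> perturb_dom Omega u w (s, x)) ->
  exists2 M, 0 <= M & forall s x, `|s| <= r -> supp w x -> `|(D1 en) (s, x)| <= M.
Proof.
move=> rD; have [_ cw wO] := tw.
have cK : compact (`[- r, r] `*` supp w) by apply: compact_setX => //; exact: segment_compact.
have cD : {within `[- r, r] `*` supp w, continuous D1 en}.
  apply: continuous_in_subspaceT => -[s x] /set_mem[/= sr /wO Ox].
  have Dp : perturb_dom Omega u w (s, x).
    by apply: rD => //; move: sr; rewrite in_itv/= ler_norml.
  apply: smooth_on_continuous Dp; apply: smooth_on_derive.
  exact: smooth_perturb_energy.
have /compact_bounded[M [_ HM]] := continuous_compact cD cK.
exists (`|M| + 1); first by rewrite addr_ge0.
move=> s x sr wx; apply: (HM (`|M| + 1)).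
  by rewrite ltr_pwDr// ler_norm.
by exists (s, x) => //; split=> //=; rewrite in_itv/= -ler_norml.
Qed.

Lemma Bellettini_first_variation :
  ((Bellettini_energy eps Omega (fun x => (u x + s * w x)%R) -
    Bellettini_energy eps Omega u) * s^-1%:E)%E @[s --> 0^'] -->
  (\int[lambda]_(x in Omega) (grad_density (@ebase R N) eps u x * w x)%:E)%E.
Proof.
have mO := measurable_rV_open oO.
have [r r0 rD] := perturb_dom_near0 oO su u0 tw.
have [M M0 bM] := perturb_derive_bound rD.
have intE s : `|s| <= r -> lambda.-integrable Omega (EFin \o (fun x => en (s, x))).
  by move=> sr; exact: (integrable_perturb oO eps0 su u0 tw finE rD sr).
have D1E s x : partial1of2 (fun s x => en (s, x)) s x = (D1 en) (s, x).
  by rewrite /partial1of2 derive1_slice.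
have norm_itv (s : R) : `]- r, r[%classic s -> `|s| <= r.
  by rewrite /= in_itv/= => /andP[/ltW ? /ltW ?]; rewrite ler_norml; apply/andP.
pose F s := (\int[lambda]_(x in Omega) en (s, x))%R.
(* The dominating function is a constant, which is integrable because Omega is
   bounded. *)
have dF : h^-1 *: (F (h + 0) - F 0) @[h --> 0^'] -->
    (\int[lambda]_(x in Omega) partial1of2 (fun s x => en (s, x)) 0 x)%R.
  apply: (@cvg_differentiation_under_integral R _ _ lambda (fun s x => en (s, x))
    Omega mO 0 (- r) r _ _ _ (cst M)).
  - by rewrite /= in_itv/= oppr_lt0 r0.
  - by move=> s /norm_itv; exact: intE.
  - move=> s x /norm_itv sr Ox; apply/derivable1_diffP.
    apply: (@differentiable_slice1 _ _ en).
    have Dp : perturb_dom Omega u w (s, x) by exact: rD.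
    by apply: smooth_on_differentiable Dp; exact: smooth_perturb_energy.
  - by [].
  - apply: measurable_bounded_integrable => //; first exact: bounded_finite_measure.
    exact: bounded_cst.
  - move=> s x /norm_itv sr Ox /=.
    have [wx|nwx] := pselect (supp w x); first by rewrite D1E; exact: bM.
    rewrite /partial1of2 (_ : (fun t => _) = cst (en (0, x))).
      by rewrite derive1_cst normr0.
    by apply/funext => t; exact: perturb_energy_suppC.
have [igw itot totE] := integral_first_variation eps oO su u0 tw.
have fin_grad : (\int[lambda]_(x in Omega)
    (grad_density (@ebase R N) eps u x * w x)%:E)%E \is a fin_num.
  exact: integrable_fin_num.
rewrite -(fineK fin_grad).
have limE : (\int[lambda]_(x in Omega) partial1of2 (fun s x => en (s, x)) 0 x)%R =
    2 * fine (\int[lambda]_(x in Omega)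
                 (grad_density (@ebase R N) eps u x * w x)%:E)%E.
  rewrite [2 * _](_ : _ = fine (2%:E * (\int[lambda]_(x in Omega)
     (grad_density (@ebase R N) eps u x * w x)%:E))%E); last by rewrite fineM.
  congr fine.
  rewrite (eq_integral (fun x => (2 * (grad_density (@ebase R N) eps u x * w x +
     \sum_(i < N) 'D_(ebase R i) (boundary_field (@ebase R N) eps u w i) x))%:E)).
    by under eq_integral do rewrite EFinM; rewrite integralZl// totE.
  move=> x /set_mem Ox; rewrite D1E; congr EFin.
  exact: (derive_perturb_energy oO eps0 su u0 tw Ox).
have BE s : `|s| <= r ->
    Bellettini_energy eps Omega (fun x => u x + s * w x) = (2^-1 * F s)%:E.
  move=> sr; rewrite Bellettini_perturbE EFinM fineK//.
  by apply: integrable_fin_num => //; exact: intE.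
have quotE : \forall s \near 0^', (2^-1 * (s^-1 *: (F (s + 0) - F 0)))%:E =
    ((Bellettini_energy eps Omega (fun x => (u x + s * w x)%R) -
      Bellettini_energy eps Omega u) * s^-1%:E)%E.
  have r0' : 0 <= r by exact: ltW.
  have B0 : Bellettini_energy eps Omega u = (2^-1 * F 0)%:E.
    rewrite -BE ?normr0//; congr (Bellettini_energy eps Omega _).
    by apply/funext => x; rewrite mul0r addr0.
  near=> s; rewrite BE ?B0 ?addr0; last first.
    by apply: ltW; near: s; exact: dnbhs0_lt.
  by rewrite -EFinB -EFinM; congr EFin; rewrite /GRing.scale/=; ring.
apply: cvg_trans (near_eq_cvg quotE) _.
apply: cvg_EFin; first exact: nearW.
rewrite -[X in _ --> X](mulKf (_ : (2 : R) != 0))// -limE.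
exact: cvgMl_tmp dF.
Unshelve. all: by end_near. Qed.

End gradient.

(** * Bump functions and the fundamental lemma *)

Section flat_exponential.
Variable R : realType.
Implicit Types (p : {poly R}) (x y z : R).

(** Polynomials in 1/y times exp(- 1/y), extended by zero to y <= 0: this class
    is closed under differentiation and contains, for p = 1, the usual flat
    function from which bump functions are made. *)
Definition flat p y : R := if 0 < y then p.[y^-1] * expR (- y^-1) else 0.

(** From z/n <= 1 + z/n <= exp (z/n), raised to the power n. *)
Lemma exprn_expRN_bounded n : exists C : R, forall z, 0 < z -> z ^+ n * expR (- z) <= C.
Proof.
case: n => [|n].
  exists 1 => z z0; rewrite expr0 mul1r -expR0 ler_expR oppr_le0; exact: ltW.
exists (n.+1%:R ^+ n.+1) => z z0.
rewrite expRN ler_pdivrMr ?expR_gt0//.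
(* Both sides become n.+1-th powers. *)
have -> : z = n.+1%:R * (z / n.+1%:R) by rewrite mulrC divfK.
rewrite expRM_natl exprMn ler_wpM2l ?exprn_ge0// ?ler0n//.
rewrite lerXn2r ?nnegrE ?expR_ge0// ?divr_ge0 ?ler0n//; first exact: ltW.
by rewrite (le_trans _ (expR_ge1Dx _))// lerDr.
Qed.

(** The factor y^2 makes the difference quotient at 0 tend to 0. *)
Lemma flat_bounded p : exists2 C : R, 0 <= C & forall y, 0 < y ->
  `|p.[y^-1] * expR (- y^-1)| <= C * y ^+ 2.
Proof.
have [C HC] := choice exprn_expRN_bounded.
exists (\sum_(i < size p) `|p`_i| * `|C (i + 2)%N|).
  by apply: sumr_ge0 => i _; rewrite mulr_ge0.
move=> y y0; have z0 : 0 < y^-1 by rewrite invr_gt0.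
rewrite -ler_pdivrMr ?exprn_gt0// -exprVn normrM (ger0_norm (expR_ge0 _)).
rewrite horner_coef -mulrA.
apply: le_trans (ler_wpM2r _ (ler_norm_sum _ _ _)) _.
  by rewrite mulr_ge0 ?expR_ge0// exprn_ge0// ltW.
rewrite mulr_suml; apply: ler_sum => i _; rewrite normrM -mulrA ler_wpM2l//.
rewrite ger0_norm ?exprn_ge0 ?(ltW z0)//.
apply: le_trans (ler_norm _); rewrite mulrCA mulrC -exprD; exact: HC.
Qed.

Lemma derive_flat p y : derivable (flat p) y 1 /\
  'D_1 (flat p) y = flat ((p - p^`()) * 'X^2) y.
Proof.
have [y0|y0|->] := ltgtP y 0.
- have E z : [set z | z < 0] z -> flat p z = cst 0 z.
    by move=> /= z0; rewrite /flat ltNge ltW.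
  have oA : open [set z : R | z < 0] by exact: open_lt.
  split; last by rewrite (eq_on_derive (1 : R) oA y0 E) derive_cst /flat ltNge ltW.
  apply/derivable1_diffP; apply: (eq_on_differentiable oA y0 (f := cst 0)).
    by move=> z z0; rewrite E.
  exact: differentiable_cst.
- pose g z := p.[z^-1] * expR (- z^-1).
  have E z : [set z | 0 < z] z -> flat p z = g z by move=> /= z0; rewrite /flat z0.
  have oA : open [set z : R | 0 < z] by exact: open_gt.
  have y_neq0 := lt0r_neq0 y0.
  have di : differentiable (fun z : R => z^-1) y by exact: differentiable_Rinv.
  have Di : 'D_1 (fun z : R => z^-1) y = - y^-1 ^+ 2.
    rewrite (@deriveV _ _ id)//= derive_id /GRing.scale/= mulr1 exprVn.
    by [].
  have dN : differentiable (fun z : R => - z^-1) y by exact: differentiableN.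
  have DN : 'D_1 (fun z : R => - z^-1) y = y^-1 ^+ 2.
    by rewrite (@deriveN _ _ _ (fun z : R => z^-1))// ?Di ?opprK//; exact: diff_derivable.
  have dp : differentiable (horner p \o (fun z : R => z^-1)) y.
    by apply: differentiable_comp => //; exact/derivable1_diffP/derivable_horner.
  have de : differentiable (expR \o (fun z : R => - z^-1)) y.
    by apply: differentiable_comp => //; exact/derivable1_diffP/derivable_expR.
  have dg : differentiable g y.
    exact: (@differentiableM _ _ (horner p \o (fun z : R => z^-1))
      (expR \o (fun z : R => - z^-1))).
  have Dg : 'D_1 g y = ((p - p^`()) * 'X^2).[y^-1] * expR (- y^-1).
    have dE : derivable (@expR R) (- y^-1) 1 by exact: derivable_expR.
    have dH : derivable (horner p) (y^-1) 1 by exact: derivable_horner.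
    rewrite (derive_mul (1 : R) dp de) (derive_comp_real (1 : R) dN dE).
    rewrite (derive_comp_real (1 : R) di dH) DN Di.
    have DE : derive1 (@expR R) (- y^-1) = expR (- y^-1) by rewrite derive1E derive_val.
    rewrite DE -derivE.
    by rewrite !hornerE /=; ring.
  split; last by rewrite (eq_on_derive (1 : R) oA y0 E) Dg /flat y0.
  apply/derivable1_diffP; apply: (eq_on_differentiable oA y0 (f := g)) => //.
  by move=> z z0; rewrite E.
- have flat0 : flat ((p - p^`()) * 'X^2) 0 = 0 by rewrite /flat ltxx.
  (* At 0 the difference quotient is bounded by C h. *)
  have cv : (fun h => h^-1 *: ((flat p \o shift 0) (h *: 1) - flat p 0)) @ 0^' --> (0 : R).
    have [C C0 HC] := flat_bounded p.
    have C1 : 0 < C + 1 by rewrite ltr_wpDl.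
    apply/cvgrPdist_le => e e0.
    near=> h; rewrite sub0r normrN [flat p 0]/flat ltxx subr0 /=.
    rewrite addr0 [h%:A]mulr1.
    have h0 : h != 0 by near: h; exact: nbhs_dnbhs_neq.
    rewrite /flat; case: ifPn => hp; last by rewrite scaler0 normr0 ltW.
    rewrite normrM normfV (@le_trans _ _ (`|h|^-1 * (C * h ^+ 2)))//.
      by rewrite ler_wpM2l ?invr_ge0// HC.
    rewrite gtr0_norm// (_ : h^-1 * (C * h ^+ 2) = C * h); last by field.
    apply: (@le_trans _ _ (h * (C + 1))).
      by rewrite mulrC ler_wpM2l// ?lerDl// ltW.
    rewrite -ler_pdivlMr// ltW// (le_lt_trans (ler_norm h))//.
    by near: h; apply: dnbhs0_lt; rewrite divr_gt0.
  rewrite flat0; split; last exact: cvg_lim cv.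
  by apply: cvgP cv.
Unshelve. all: by end_near. Qed.

Lemma smooth_flat p : smooth_on [set: R] (flat p).
Proof.
apply: (@smooth_coind _ _ _ (fun f => exists q, f = flat q)); [exact: openT| |by exists p].
move=> _ [q ->]; have dq x : differentiable (flat q) x.
  by apply/derivable1_diffP; exact: (derive_flat q x).1.
split=> [x _|v]; first exact: dq.
(* The direction v of the derivative is absorbed in the polynomial. *)
exists (flat (v%:P * ((q - q^`()) * 'X^2))); first by eexists.
move=> x _; rewrite deriveE// diff1E// derive1E (derive_flat q x).2 /flat /GRing.scale/=.
by case: ifP => _; rewrite ?mulr0// [in RHS]hornerM hornerC mulrA.
Qed.

End flat_exponential.

Section bump_fun.
Variables (R : realType) (N : nat).
Implicit Types (c x : 'rV[R]_N) (r : R).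
Local Notation lambda := (lebesgue_rV R N).

Lemma smooth_coord (A : set 'rV[R]_N) i : open A ->
  smooth_on A (fun x => x ord0 i).
Proof.
move=> oA; have @f : {linear 'rV[R]_N -> R}.
  by exists (fun x : 'rV[R]_N => x ord0 i); do 2![eexists]; do ?[constructor];
     rewrite ?mxE// => ? *; rewrite ?mxE//; move=> ?; rewrite !mxE.
by apply: (@smooth_on_linear _ _ _ f) => //; exact: coord_continuous.
Qed.

Definition bump_fun c r x : R :=
  \prod_(i < N) flat 1 (r ^+ 2 - (x ord0 i - c ord0 i) ^+ 2).

Lemma flat_ge0 (y : R) : 0 <= flat 1 y.
Proof. by rewrite /flat hornerC mul1r; case: ifP => // _; exact: expR_ge0. Qed.

Lemma flat_gt0 (y : R) : (0 < flat 1 y) = (0 < y).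
Proof.
by rewrite /flat hornerC mul1r; case: ifP => _; rewrite ?expR_gt0 ?ltxx.
Qed.

Lemma smooth_bump c r : smooth_on setT (bump_fun c r).
Proof.
have oT : open [set: 'rV[R]_N] by exact: openT.
apply: smooth_on_prod => // i.
apply: (smooth_on_comp oT (@smooth_flat R 1)
  (f := fun x : 'rV[R]_N => r ^+ 2 - (x ord0 i - c ord0 i) ^+ 2)).
apply: smooth_onB => //; first exact: (@smooth_on_cst _ _ _ (r ^+ 2)).
apply: smooth_onX => //; apply: smooth_onB => //; first exact: smooth_coord.
exact: (@smooth_on_cst _ _ _ (c ord0 i)).
Qed.

Lemma bump_ge0 c r x : 0 <= bump_fun c r x.
Proof. by apply: prodr_ge0 => i _; exact: flat_ge0. Qed.

Lemma bump_factor_gt0 c r x i : 0 < r ->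
  (0 < r ^+ 2 - (x ord0 i - c ord0 i) ^+ 2) = (`|x ord0 i - c ord0 i| < r).
Proof.
move=> r0; rewrite subr_gt0 -[X in X < _]real_normK ?num_real//.
by rewrite ltr_pXn2r// nnegrE// ltW.
Qed.

Lemma bump_gt0 c r x : 0 < r -> (forall i, `|x ord0 i - c ord0 i| < r) ->
  0 < bump_fun c r x.
Proof.
by move=> r0 xc; apply: prodr_gt0 => i _; rewrite flat_gt0 bump_factor_gt0.
Qed.

Lemma bump_neq0 c r x : 0 < r -> bump_fun c r x != 0 ->
  forall i, `|x ord0 i - c ord0 i| < r.
Proof.
move=> r0 bx i; rewrite -bump_factor_gt0// -flat_gt0 lt_neqAle flat_ge0 andbT eq_sym.
by apply: contraNneq bx => b0; rewrite /bump_fun (bigD1 i)//= b0 mul0r.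
Qed.

Lemma test_bump (Omega : set 'rV[R]_N) c r : 0 < r ->
  (forall x, (forall i, `|x ord0 i - c ord0 i| <= r) -> Omega x) ->
  test_function Omega (bump_fun c r).
Proof.
move=> r0 cO.
pose K := [set x : 'rV[R]_N | forall i, `[c ord0 i - r, c ord0 i + r]%classic (x ord0 i)].
have cK : compact K.
  apply: (@rV_compact R N (fun i => `[c ord0 i - r, c ord0 i + r]%classic)) => i.
  exact: segment_compact.
have KP x : K x <-> forall i, `|x ord0 i - c ord0 i| <= r.
  by split=> Kx i; have := Kx i; rewrite /= in_itv/= ler_distl.
have bK : closure [set x | bump_fun c r x != 0] `<=` K.
  have -> : K = closure K.
    by apply/closure_id; apply: compact_closed => //; exact: norm_hausdorff.
  by apply: closure_subset => x /= /(bump_neq0 r0) xc; apply/KP => i; exact/ltW/xc.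
split.
- exact: smooth_bump.
- exact: subclosed_compact (@closed_closure _ _) cK bK.
- by move=> x /bK/KP; exact: cO.
Qed.

Lemma lebesgue_rV_box_gt0 c r : 0 < r ->
  (0 < lambda [set x | forall i, `](c ord0 i - r)%R, (c ord0 i + r)%R[%classic (x ord0 i)])%E.
Proof.
move=> r0; rewrite (@lebesgue_rV_box _ _ (fun i => `](c ord0 i - r), c ord0 i + r[%classic))//.
apply: (big_ind (fun a => 0 < a)%E) => [|a b a0 b0|i _]; first exact: lte01.
  exact: mule_gt0.
rewrite lebesgue_measure_itv/= lte_fin ltrD2l gtrN// -EFinB lte_fin.
by rewrite subr_gt0 ltrD2l gtrN.
Qed.

(** If g were positive at c, it would be so on a box around c; the integral of g
    against a bump supported there vanishes only if the box is negligible. *)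
Lemma fundamental_lemma_pos (Omega : set 'rV[R]_N) (g : 'rV[R]_N -> R) :
  open Omega -> (forall x, Omega x -> {for x, continuous g}) ->
  (forall w, test_function Omega w ->
    (\int[lambda]_(x in Omega) (g x * w x)%:E = 0)%E) ->
  forall x, Omega x -> g x <= 0.
Proof.
move=> oO cg g0 c Oc; rewrite leNgt; apply/negP => gc.
have /nbhs_ballP[r /= r0 rB] : nbhs c (Omega `&` [set x | 0 < g x]).
  apply: filterI; first exact: open_nbhs_nbhs.
  exact: (cvgr_gt _ (cg c Oc)).
have r20 : 0 < r / 2 by rewrite divr_gt0.
have rB' x : (forall i, `|x ord0 i - c ord0 i| <= r / 2) -> Omega x /\ 0 < g x.
  move=> xc; apply: rB; rewrite -ball_normE/= distrC.
  rewrite (@le_lt_trans _ _ (r / 2))// ?ltr_pdivrMr// ?ltr_pMr// ?ltr1n//.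
  by apply/rV_normP => [|i]; [exact: ltW|rewrite !mxE].
have tb : test_function Omega (bump_fun c (r / 2)) by apply: test_bump => // x /rB'[].
pose f x := (g x * bump_fun c (r / 2) x)%:E.
have f0 x : Omega x -> (0 <= f x)%E.
  move=> Ox; rewrite lee_fin; have [->|bx] := eqVneq (bump_fun c (r / 2) x) 0.
    by rewrite mulr0.
  rewrite mulr_ge0 ?bump_ge0//; apply/ltW; apply: (rB' x _).2 => i.
  exact/ltW/(bump_neq0 r20 bx).
have mO := measurable_rV_open oO.
have mf : measurable_fun Omega f.
  apply/measurable_EFinP; apply: continuous_measurable_rV => // x Ox.
  apply: continuousM; first exact: cg.
  exact: smooth_on_continuous (smooth_bump _ _) I.
have /(ae_eq_integral_abs _ mO mf) : (\int[lambda]_(x in Omega) `|f x| = 0)%E.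
  rewrite (eq_integral f); first exact: g0.
  by move=> x /set_mem Ox; rewrite gee0_abs// f0.
move=> [Z [mZ Z0 fZ]].
have := lebesgue_rV_box_gt0 c r20; rewrite ltNge => /negP; apply.
rewrite -Z0; apply: le_measure; rewrite ?inE//.
  apply: (@measurable_rV_box _ _ (fun i => `](c ord0 i - r / 2), c ord0 i + r / 2[%classic)).
  by move=> i.
move=> x xB; apply: fZ => /=.
have xc i : `|x ord0 i - c ord0 i| < r / 2.
  by have := xB i; rewrite /= in_itv/= ltr_distl.
have [Ox gx] := rB' x (fun i => ltW (xc i)).
move=> /(_ Ox) [/eqP]; rewrite mulf_eq0 gt_eqF//= gt_eqF//; exact: bump_gt0.
Qed.

Lemma fundamental_lemma (Omega : set 'rV[R]_N) (g : 'rV[R]_N -> R) :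
  open Omega -> (forall x, Omega x -> {for x, continuous g}) ->
  (forall w, test_function Omega w ->
    (\int[lambda]_(x in Omega) (g x * w x)%:E = 0)%E) ->
  forall x, Omega x -> g x = 0.
Proof.
move=> oO cg g0 x Ox; apply/eqP; rewrite eq_le (fundamental_lemma_pos oO cg g0 Ox)/=.
rewrite -oppr_le0.
apply: (@fundamental_lemma_pos Omega (fun x => - g x) oO _ _ x Ox).
  by move=> y Oy; apply: continuousN; exact: cg.
move=> w tw.
rewrite (eq_integral (fun x => (g x * (- 1 * w x))%:E)); last first.
  by move=> y _; congr EFin; ring.
apply: g0; apply: test_mul => //.
exact: (@smooth_on_cst _ _ _ (-1)).
Qed.

End bump_fun.

(** * Gradient flow *)

Section gradient_flow.
Variables (R : realType) (N : nat) (Omega : set 'rV[R]_N) (eps : R).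
Hypotheses (oO : open Omega) (bO : bounded_set Omega) (eps0 : 0 < eps).
Local Notation lambda := (lebesgue_rV R N).

Lemma Bellettini_L2_gradient (u : 'rV[R]_N -> R) :
  smooth_on Omega u -> (forall x, Omega x -> grad u x != 0) ->
  (Bellettini_energy eps Omega u < +oo)%E ->
  is_L2_gradient Omega (Bellettini_energy eps Omega) u
    (fun x => - eps * Bellettini_rhs eps u x).
Proof.
move=> su u0 finE w tw.
have pos x : Omega x -> 0 < gradsq (@ebase R N) u x by move=> /u0 /gradsq_gt0.
rewrite (_ : (fun x => (- eps * Bellettini_rhs eps u x * w x)%:E) =
    (fun x => (grad_density (@ebase R N) eps u x * w x)%:E)); last first.
  by apply/funext => x; rewrite Bellettini_rhsE// gt_eqF.
split; last exact: Bellettini_first_variation.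
by have [] := integral_first_variation eps oO su pos tw.
Qed.

(** The two gradients are functions on the whole space, arbitrary outside Omega;
    g is a continuous representative of their difference on Omega, to which the
    fundamental lemma applies. *)
Lemma L2_gradient_unique (F : ('rV[R]_N -> R) -> \bar R) (u g1 g2 g : 'rV[R]_N -> R) :
  is_L2_gradient Omega F u g1 -> is_L2_gradient Omega F u g2 ->
  (forall x, Omega x -> g1 x - g2 x = g x) ->
  (forall x, Omega x -> {for x, continuous g}) ->
  forall x, Omega x -> g1 x = g2 x.
Proof.
move=> G1 G2 gE cg x Ox; apply/eqP; rewrite -subr_eq0 gE//; apply/eqP.
apply: (fundamental_lemma oO cg _ Ox) => w tw.
have [i1 l1] := G1 w tw; have [i2 l2] := G2 w tw.
have mO := measurable_rV_open oO.
have e12 := cvg_unique (@ereal_hausdorff R) l1 l2.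
rewrite (eq_integral (fun x => (g1 x * w x)%:E - (g2 x * w x)%:E)%E); last first.
  by move=> y /set_mem Oy; rewrite -gE// mulrBl EFinB.
rewrite integralB//.
rewrite e12 subee//.
exact: integrable_fin_num.
Qed.

End gradient_flow.

Theorem proposition3p1 (R : realType) (n : nat) (Omega : set 'rV[R]_n.+1)
    (eps : R) :
  open Omega -> bounded_set Omega -> lipschitz_boundary Omega -> 0 < eps ->
  (forall u : 'rV[R]_n.+1 -> R,
      smooth_on Omega u ->
      (forall x, Omega x -> grad u x != 0) ->
      (Bellettini_energy eps Omega u < +oo)%E ->
      is_L2_gradient Omega (Bellettini_energy eps Omega) u
        (fun x => - eps * Bellettini_rhs eps u x)) /\
  (forall (I : set R) (u : R -> 'rV[R]_n.+1 -> R),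
      open I ->
      smooth_on (I `*` Omega) (fun p : (R * 'rV[R]_n.+1)%type => u p.1 p.2) ->
      (forall t x, I t -> Omega x -> grad (u t) x != 0) ->
      (forall t, I t -> (Bellettini_energy eps Omega (u t) < +oo)%E) ->
      (rescaled_L2_gradient_flow Omega eps (Bellettini_energy eps Omega) I u <->
       forall t x, I t -> Omega x ->
         derive1 (fun s => u s x) t = Bellettini_rhs eps (u t) x)).
Proof.
move=> oO bO _ eps0; have eps_neq0 := lt0r_neq0 eps0.
split; first by move=> u; exact: Bellettini_L2_gradient.
move=> I u oI su u0 finE.
have sut t : I t -> smooth_on Omega (u t).
  move=> It; apply: (@smooth_onS _ _ _ [set x | (I `*` Omega) (t, x)]); first by [].
  exact: smooth_on_slice su.
have gradE t : I t -> is_L2_gradient Omega (Bellettini_energy eps Omega) (u t)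
    (fun x => - eps * Bellettini_rhs eps (u t) x).
  move=> It; apply: Bellettini_L2_gradient => //; last exact: finE.
    exact: sut.
  by move=> x; exact: u0.
split=> [flow t x It Ox|evol t It]; last first.
  exists (fun x => - eps * Bellettini_rhs eps (u t) x); first exact: gradE.
  by move=> x Ox; rewrite evol// mulrA mulrNN mulVf// mul1r.
have [g Gg gE] := flow t It.
have pos y : Omega y -> 0 < gradsq (@ebase R n.+1) (u t) y.
  by move=> Oy; apply: gradsq_gt0; exact: u0.
pose U (p : (R * 'rV[R]_n.+1)%type) := u p.1 p.2.
pose ut y := 'D_((1 : R), (0 : 'rV[R]_n.+1)) U (t, y).
have utE y : derive1 (fun s => u s y) t = ut y by exact: (derive1_slice U).
have sut' : smooth_on Omega ut.
  apply: (@smooth_onS _ _ _ [set y | (I `*` Omega) (t, y)]); first by [].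
  exact: smooth_on_slice (smooth_on_derive ((1 : R), (0 : 'rV[R]_n.+1)) su).
rewrite gE// (L2_gradient_unique oO Gg (gradE t It)
  (g := fun y => - eps * ut y - grad_density (@ebase R n.+1) eps (u t) y))//.
- by rewrite mulrA mulrNN mulVf// mul1r.
- move=> y Oy; rewrite -utE gE// Bellettini_rhsE//.
  by rewrite mulrA mulrNN mulfV// mul1r.
- move=> y Oy; apply: smooth_on_continuous Oy; apply: smooth_onB => //.
    exact: smooth_onZ.
  exact: (smooth_grad_density eps oO (sut t It) pos).
Qed.
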